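(* It is true in $\mathbf{ZF}$ that, for every bitopological space $(X,\tau_1,\tau_2)$ and every bornology $\mathcal{B}$ in $X$, the bornological biuniverse $((X,\tau_1,\tau_2),\mathcal{B})$ is quasi-metrizable if and only if $\mathcal{B}$ has a countable base and is $(\tau_1,\tau_2)$-proper, while the bitopological space $(X,\tau_1,\tau_2)$ is quasi-metrizable.
   Context: The set theory is $\mathbf{ZF}$ (no choice). ''Countable'' means equipollent with a subset of $\omega$. A bitopological space is a triple $(X,\tau_1,\tau_2)$ where $\tau_1,\tau_2$ are topologies in the set $X$. A quasi-pseudometric in $X$ is a function $d:X\times X\to[0;+\infty)$ with $d(x,x)=0$ and $d(x,y)\le d(x,z)+d(z,y)$ for all $x,y,z\in X$; it is a quasi-metric if $d(x,y)=0$ implies $x=y$. Its conjugate is $d^{-1}(x,y)=d(y,x)$. Let $B_d(x,r)=\{y\in X: d(x,y)<r\}$ and let $\tau(d)=\{V\subseteq X:\forall_{x\in V}\exists_{n\in\omega}\ B_d(x,2^{-n})\subseteq V\}$. The bitopological space $(X,\tau_1,\tau_2)$ is quasi-metrizable if there is a quasi-metric $d$ in $X$ with $\tau_1=\tau(d)$ and $\tau_2=\tau(d^{-1})$. A boundedness in $X$ is a non-void ideal of subsets of $X$ (closed under subsets and finite unions); it is a bornology if it contains every singleton of $X$. A base for a boundedness $\mathcal{B}$ is a collection $\mathcal{A}\subseteq\mathcal{B}$ such that every member of $\mathcal{B}$ is a subset of a member of $\mathcal{A}$. A boundedness $\mathcal{B}$ in $X$ is $(\tau_1,\tau_2)$-proper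 if for each $A\in\mathcal{B}$ there is $B\in\mathcal{B}$ with $\mathrm{cl}_{\tau_2}A\subseteq\mathrm{int}_{\tau_1}B$. A bornological biuniverse is a pair $((X,\tau_1,\tau_2),\mathcal{B})$ with $(X,\tau_1,\tau_2)$ a bitopological space and $\mathcal{B}$ a bornology in $X$. A set $A\subseteq X$ is $d$-bounded if $A\subseteq B_d(x,r)$ for some $x\in X$, $r\in(0;+\infty)$; $\mathcal{B}_d(X)$ is the collection of all $d$-bounded subsets of $X$. The biuniverse is quasi-metrizable if there is a single quasi-metric $d$ in $X$ with $\tau_1=\tau(d)$, $\tau_2=\tau(d^{-1})$ and $\mathcal{B}=\mathcal{B}_d(X)$.
   Formalization: X is assumed nonempty: for X = ∅ and B = {∅}, B has a countable base, is proper and the space is quasi-metrizable, but no set is d-bounded (a centre x in X is required), so the biuniverse is not quasi-metrizable. *)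

(* Defs.v *)
(** "True in ZF" is rendered as "true in every model of first-order ZF"; by
    Goedel's completeness theorem this is the same as being provable in ZF.  The
    separation and replacement schemes range over (deeply embedded) first-order
    formulas with parameters only: with arbitrary predicates [M -> Prop] instead,
    choice in the metatheory would force the axiom of choice in the model.

    Everything else is a shallow embedding: every definition below quantifies
    only over elements of the model and is built from membership and equality, so
    that it is the interpretation in [M] of a first-order formula. *)

Set Implicit Arguments.
Unset Strict Implicit.
Unset Printing Implicit Defensive.

Record interp : Type := Interp {
  univ :> Type;
  mem : univ -> univ -> Prop
}.
Arguments mem {i} x y.

Declare Scope zf_scope.
Delimit Scope zf_scope with zf.
Open Scope zf_scope.

Notation "x ∈ y" := (mem x y) (at level 70, no associativity) : zf_scope.
Notation "x ∉ y" := (~ mem x y) (at level 70, no associativity) : zf_scope.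

(** ** First-order formulas of set theory (de Bruijn indices) *)

Inductive formula : Type :=
| FMem (i j : nat)
| FEq (i j : nat)
| FNot (p : formula)
| FAnd (p q : formula)
| FOr (p q : formula)
| FImp (p q : formula)
| FAll (p : formula)
| FEx (p : formula).

Definition extend (T : Type) (x : T) (e : nat -> T) : nat -> T :=
  fun n => match n with O => x | S k => e k end.

Fixpoint sat (M : interp) (e : nat -> M) (p : formula) : Prop :=
  match p with
  | FMem i j => e i ∈ e j
  | FEq i j => e i = e j
  | FNot p => ~ sat e p
  | FAnd p q => sat e p /\ sat e q
  | FOr p q => sat e p \/ sat e q
  | FImp p q => sat e p -> sat e q
  | FAll p => forall x, sat (extend x e) p
  | FEx p => exists x, sat (extend x e) p
  end.

(** ** The axioms of ZF *)

Definition is_empty (M : interp) (e : M) : Prop := forall z, z ∉ e.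

(** [s = x ∪ {x}] *)
Definition is_succ (M : interp) (s x : M) : Prop :=
  forall z, z ∈ s <-> z ∈ x \/ z = x.

Definition inductive_set (M : interp) (w : M) : Prop :=
  (exists e, is_empty e /\ e ∈ w) /\
  (forall x, x ∈ w -> exists s, is_succ s x /\ s ∈ w).

Record ZF (M : interp) : Prop := {
  zf_extensionality : forall x y : M, (forall z, z ∈ x <-> z ∈ y) -> x = y;
  zf_foundation : forall x : M, (exists y, y ∈ x) ->
    exists y, y ∈ x /\ forall z, z ∈ x -> z ∉ y;
  zf_pairing : forall x y : M, exists p, forall z, z ∈ p <-> z = x \/ z = y;
  zf_union : forall a : M, exists u, forall z, z ∈ u <-> exists y, y ∈ a /\ z ∈ y;
  zf_powerset : forall a : M, exists b, forall z,
    z ∈ b <-> forall y, y ∈ z -> y ∈ a;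
  zf_infinity : exists w : M, inductive_set w;
  zf_separation : forall (p : formula) (e : nat -> M) (a : M),
    exists b, forall x, x ∈ b <-> x ∈ a /\ sat (extend x e) p;
  zf_replacement : forall (p : formula) (e : nat -> M) (a : M),
    (forall x, x ∈ a -> exists! y, sat (extend x (extend y e)) p) ->
    exists b, forall y,
      y ∈ b <-> exists x, x ∈ a /\ sat (extend x (extend y e)) p
}.

(** ** Classes, pairs, functions, [ω]

    As usual in ZF, a class is a (definable) predicate; only the concrete classes
    defined below are used, and nothing is quantified over classes. *)

Definition class (M : interp) : Type := M -> Prop.

Definition elts (M : interp) (a : M) : class M := fun x => x ∈ a.

Definition subclass (M : interp) (A B : class M) : Prop := forall x, A x -> B x.

Notation "A ⊆ B" := (subclass A B) (at level 70, no associativity) : zf_scope.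

Definition same_class (M : interp) (A B : class M) : Prop := forall x, A x <-> B x.

Definition is_upair (M : interp) (p x y : M) : Prop :=
  forall z, z ∈ p <-> z = x \/ z = y.

(** Kuratowski pair: [p = {{x}, {x, y}}] *)
Definition is_opair (M : interp) (p x y : M) : Prop :=
  exists a b, is_upair a x x /\ is_upair b x y /\ is_upair p a b.

Definition cprod (M : interp) (A B : class M) : class M :=
  fun p => exists x y, A x /\ B y /\ is_opair p x y.

(** [(x, y) ∈ f], that is [f(x) = y] when [f] is a function *)
Definition app (M : interp) (f x y : M) : Prop :=
  exists p, is_opair p x y /\ p ∈ f.

(** [f(x, y) = z] *)
Definition app2 (M : interp) (f x y z : M) : Prop :=
  exists p, is_opair p x y /\ app f p z.

Definition maps (M : interp) (f : M) (A B : class M) : Prop :=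
  elts f ⊆ cprod A B /\ (forall x, A x -> exists! y, app f x y).

Definition bijection (M : interp) (f : M) (A B : class M) : Prop :=
  maps f A B /\ (forall y, B y -> exists! x, app f x y).

Definition omega (M : interp) : class M :=
  fun n => forall w, inductive_set w -> n ∈ w.

Definition countable (M : interp) (A : M) : Prop :=
  exists S f, elts S ⊆ @omega M /\ bijection f (elts A) (elts S).

(** ** The real numbers of the model

    Inside ZF the real line is the Dedekind-complete ordered field, which exists
    and is unique up to isomorphism.  Completeness only concerns subsets that are
    elements of the model. *)

Record ofield (M : interp) : Type := OField {
  car : M;
  zero : M;
  one : M;
  addR : M;
  mulR : M;
  leR : M
}.

Definition sum (M : interp) (R : ofield M) (x y z : M) : Prop := app2 (addR R) x y z.
Definition prd (M : interp) (R : ofield M) (x y z : M) : Prop := app2 (mulR R) x y z.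
Definition le (M : interp) (R : ofield M) (x y : M) : Prop := app (leR R) x y.
Definition lt (M : interp) (R : ofield M) (x y : M) : Prop := le R x y /\ x <> y.

Definition upper_bound (M : interp) (R : ofield M) (S b : M) : Prop :=
  b ∈ car R /\ forall x, x ∈ S -> le R x b.

Record real_line (M : interp) (R : ofield M) : Prop := {
  rl_zero : zero R ∈ car R;
  rl_one : one R ∈ car R;
  rl_add : maps (addR R) (cprod (elts (car R)) (elts (car R))) (elts (car R));
  rl_mul : maps (mulR R) (cprod (elts (car R)) (elts (car R))) (elts (car R));
  rl_le : elts (leR R) ⊆ cprod (elts (car R)) (elts (car R));
  rl_addA : forall x y z u v w,
    sum R x y u -> sum R y z v -> (sum R u z w <-> sum R x v w);
  rl_addC : forall x y z, sum R x y z -> sum R y x z;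
  rl_add0 : forall x, x ∈ car R -> sum R (zero R) x x;
  rl_opp : forall x, x ∈ car R -> exists y, sum R x y (zero R);
  rl_mulA : forall x y z u v w,
    prd R x y u -> prd R y z v -> (prd R u z w <-> prd R x v w);
  rl_mulC : forall x y z, prd R x y z -> prd R y x z;
  rl_mul1 : forall x, x ∈ car R -> prd R (one R) x x;
  rl_inv : forall x, x ∈ car R -> x <> zero R -> exists y, prd R x y (one R);
  rl_distr : forall x y z s u v w,
    sum R y z s -> prd R x y u -> prd R x z v -> sum R u v w -> prd R x s w;
  rl_neq : one R <> zero R;
  rl_le_anti : forall x y, le R x y -> le R y x -> x = y;
  rl_le_trans : forall x y z, le R x y -> le R y z -> le R x z;
  rl_le_total : forall x y, x ∈ car R -> y ∈ car R -> le R x y \/ le R y x;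
  rl_le_add : forall x y z u v,
    le R x y -> sum R x z u -> sum R y z v -> le R u v;
  rl_le_mul : forall x y z,
    le R (zero R) x -> le R (zero R) y -> prd R x y z -> le R (zero R) z;
  rl_complete : forall S, elts S ⊆ elts (car R) -> (exists x, x ∈ S) ->
    (exists b, upper_bound R S b) ->
    exists l, upper_bound R S l /\ forall b, upper_bound R S b -> le R l b
}.

Definition nonneg (M : interp) (R : ofield M) : class M :=
  fun r => r ∈ car R /\ le R (zero R) r.

(** [r = 2^{-n}]: [h : ω → R] is given by [h(0) = 1] and
    [h(m + 1) + h(m + 1) = h(m)]. *)
Definition is_pow2inv (M : interp) (R : ofield M) (n r : M) : Prop :=
  exists h, maps h (@omega M) (elts (car R)) /\
    (forall e, is_empty e -> app h e (one R)) /\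
    (forall m s a b, omega m -> is_succ s m -> app h m a -> app h s b ->
       sum R b b a) /\
    app h n r.

(** ** Bitopological spaces *)

Definition topology (M : interp) (X t : M) : Prop :=
  (forall V, V ∈ t -> elts V ⊆ elts X) /\
  (forall e, is_empty e -> e ∈ t) /\
  X ∈ t /\
  (forall U V W, U ∈ t -> V ∈ t ->
     (forall x, x ∈ W <-> x ∈ U /\ x ∈ V) -> W ∈ t) /\
  (forall F U, elts F ⊆ elts t ->
     (forall x, x ∈ U <-> exists V, V ∈ F /\ x ∈ V) -> U ∈ t).

Definition bitopological (M : interp) (X t1 t2 : M) : Prop :=
  topology X t1 /\ topology X t2.

Definition interior (M : interp) (t A : M) : class M :=
  fun x => exists U, U ∈ t /\ elts U ⊆ elts A /\ x ∈ U.

Definition closed_set (M : interp) (X t C : M) : Prop :=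
  elts C ⊆ elts X /\
  exists U, U ∈ t /\ forall x, x ∈ U <-> x ∈ X /\ x ∉ C.

Definition closure (M : interp) (X t A : M) : class M :=
  fun x => x ∈ X /\ forall C, closed_set X t C -> elts A ⊆ elts C -> x ∈ C.

(** ** Quasi-metrics *)

(** [D x y r] reads "the distance from [x] to [y] is [r]". *)
Definition dist (M : interp) (d : M) : M -> M -> M -> Prop := app2 d.
Definition conj_dist (M : interp) (d : M) : M -> M -> M -> Prop :=
  fun x y r => app2 d y x r.

Definition quasi_pseudometric (M : interp) (R : ofield M) (X d : M) : Prop :=
  maps d (cprod (elts X) (elts X)) (nonneg R) /\
  (forall x, x ∈ X -> dist d x x (zero R)) /\
  (forall x y z a b c s, x ∈ X -> y ∈ X -> z ∈ X ->
     dist d x y a -> dist d x z b -> dist d z y c -> sum R b c s -> le R a s).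

Definition quasi_metric (M : interp) (R : ofield M) (X d : M) : Prop :=
  quasi_pseudometric R X d /\
  (forall x y, x ∈ X -> y ∈ X -> dist d x y (zero R) -> x = y).

Definition ball (M : interp) (R : ofield M) (X : M) (D : M -> M -> M -> Prop)
    (x r : M) : class M :=
  fun y => y ∈ X /\ exists s, D x y s /\ lt R s r.

Definition tau (M : interp) (R : ofield M) (X : M) (D : M -> M -> M -> Prop) :
    class M :=
  fun V => elts V ⊆ elts X /\
    forall x, x ∈ V -> exists n r,
      omega n /\ is_pow2inv R n r /\ ball R X D x r ⊆ elts V.

Definition induces (M : interp) (R : ofield M) (X t1 t2 d : M) : Prop :=
  same_class (elts t1) (tau R X (dist d)) /\
  same_class (elts t2) (tau R X (conj_dist d)).

Definition quasi_metrizable (M : interp) (R : ofield M) (X t1 t2 : M) : Prop :=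
  exists d, quasi_metric R X d /\ induces R X t1 t2 d.

(** ** Bornologies *)

Definition boundedness (M : interp) (X B : M) : Prop :=
  (exists A, A ∈ B) /\
  (forall A, A ∈ B -> elts A ⊆ elts X) /\
  (forall A C, A ∈ B -> elts C ⊆ elts A -> C ∈ B) /\
  (forall A C U, A ∈ B -> C ∈ B -> (forall x, x ∈ U <-> x ∈ A \/ x ∈ C) -> U ∈ B).

Definition bornology (M : interp) (X B : M) : Prop :=
  boundedness X B /\
  (forall x s, x ∈ X -> is_upair s x x -> s ∈ B).

Definition base_of (M : interp) (B A : M) : Prop :=
  elts A ⊆ elts B /\
  forall C, C ∈ B -> exists D, D ∈ A /\ elts C ⊆ elts D.

Definition has_countable_base (M : interp) (B : M) : Prop :=
  exists A, base_of B A /\ countable A.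

Definition proper (M : interp) (X t1 t2 B : M) : Prop :=
  forall A, A ∈ B -> exists C, C ∈ B /\ closure X t2 A ⊆ interior t1 C.

Definition d_bounded (M : interp) (R : ofield M) (X d : M) : class M :=
  fun A => elts A ⊆ elts X /\
    exists x r, x ∈ X /\ r ∈ car R /\ lt R (zero R) r /\
      elts A ⊆ ball R X (dist d) x r.

Definition quasi_metrizable_biuniverse (M : interp) (R : ofield M)
    (X t1 t2 B : M) : Prop :=
  exists d, quasi_metric R X d /\ induces R X t1 t2 d /\
    same_class (elts B) (d_bounded R X d).

(* Main.v *)
(** For the converse implication, let [d] be a quasi-metric inducing the two
    topologies, truncated at 1, and let [C_n] be the union of the first [n] members
    of a countable base of the bornology.  By properness there is a least [m] with
    [cl_2 C_n ⊆ int_1 C_m]; put [D_n = C_m].  With [a_n(x) = d(C_n, x)] and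
    [b_n(x) = d(x, X \ D_n)], the Urysohn function [u_n = a_n / (a_n + b_n)] vanishes
    on [C_n], is 1 off [D_n], and satisfies
    [u_n(y) - u_n(x) ≤ d(x, y) / (a_n + b_n)] with the denominator taken at either of
    the two points.  Hence [F = sup_n 2^n u_n] is upper semicontinuous for the first
    topology, lower semicontinuous for the second, and bounded exactly on the members
    of the bornology, so [max (d(x, y), F(y) - F(x))] is the required quasi-metric.
    No step chooses anything, and the least [m] avoids any recursion on sets.

    Inside the model every auxiliary set comes from separation, so all predicates
    must be definable by a formula.  The real line of the model is turned into a
    [realFieldType] whose operations are definable. *)

From HB Require Import structures.
From mathcomp Require Import all_boot all_order all_algebra.
From mathcomp Require Import boolp lra.
Require Import Defs.
Import Order.TTheory GRing.Theory Num.Theory.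

Set Implicit Arguments.
Unset Strict Implicit.
Unset Printing Implicit Defensive.

(** * Definable predicates *)

(* The truncation keeps the old quasi-metric from adding unboundedness: the sets bounded for the
   maximum are then those on which [F] is bounded. The sum a_n + b_n is positive because a_n(x) = 0
   puts x in the second closure of C_n, hence in the first interior of D_n, where b_n(x) > 0. Either
   point may carry the denominator so that it always stays at the fixed point, in the upper as in
   the lower estimate. The weights 2^n are inverses of the radii 2^-n that already occur in the
   definition of the topologies.

   The obstacle is that the natural numbers and the reals of the model may be nonstandard:
   induction, least numbers, finite minima and suprema are available for definable predicates only.
   Definability is therefore a semantic notion, agreement in truth value with some formula with
   parameters, and a tactic derives it from the shape of a Rocq predicate. Classical axioms of the
   metatheory act on the Rocq side only; sets of the model come from the axioms of ZF alone, so no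
   choice leaks into the model. *)
Existing Class ZF.

Section Definability.
Context {M : interp}.
Implicit Types (v c e : nat -> M) (p q : formula) (P Q : (nat -> M) -> Prop).

Definition up (r : nat -> nat) (n : nat) : nat :=
  if n is k.+1 then (r k).+1 else 0.

Fixpoint rename (r : nat -> nat) (p : formula) : formula :=
  match p with
  | FMem i j => FMem (r i) (r j)
  | FEq i j => FEq (r i) (r j)
  | FNot p => FNot (rename r p)
  | FAnd p q => FAnd (rename r p) (rename r q)
  | FOr p q => FOr (rename r p) (rename r q)
  | FImp p q => FImp (rename r p) (rename r q)
  | FAll p => FAll (rename (up r) p)
  | FEx p => FEx (rename (up r) p)
  end.

Lemma sat_rename p : forall r e, sat e (rename r p) <-> sat (fun n => e (r n)) p.
Proof.
have up_ext r e x : (fun n => extend x e (up r n)) = extend x (fun n => e (r n)).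
  by apply: funext => -[].
elim: p => //=.
- by move=> p IH r e; split=> H ?; apply: H; apply/IH.
- by move=> p IHp q IHq r e; rewrite IHp IHq.
- by move=> p IHp q IHq r e; rewrite IHp IHq.
- by move=> p IHp q IHq r e; rewrite IHp IHq.
- by move=> p IH r e; split=> H x; have := H x; rewrite IH up_ext.
- by move=> p IH r e; split=> -[x H]; exists x; move: H; rewrite IH up_ext.
Qed.

(* An environment for the free variables [v] and the parameters [c]. *)
Definition mix v c (n : nat) : M := if odd n then c n./2 else v n./2.

Lemma mix_even v c k : mix v c k.*2 = v k.
Proof. by rewrite /mix odd_double doubleK. Qed.

Lemma mix_odd v c k : mix v c k.*2.+1 = c k.
Proof. by rewrite /mix /= odd_double uphalf_double. Qed.

(** [P] is any Rocq predicate on environments, tied to a formula through truth values only.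
    Variables sit at the even indices and parameters at the odd ones, so both streams are infinite
    and neither has to be counted when formulas are combined. *)
Definition definable P : Prop :=
  exists p c, forall v, P v <-> sat (mix v c) p.

(** The language has no function symbols, so a term is represented by its graph, with the value at
    index 0 and the arguments moved up by one. *)
Definition def_term (t : (nat -> M) -> M) : Prop :=
  definable (fun v => v 0 = t (fun n => v n.+1)).

Definition definable_rel (P : M -> M -> Prop) : Prop :=
  forall s t, def_term s -> def_term t -> definable (fun v => P (s v) (t v)).

Lemma definable_ext P Q : (forall v, P v <-> Q v) -> definable Q -> definable P.
Proof. by move=> PQ [p [c H]]; exists p, c => v; rewrite PQ. Qed.

(** The parameter streams are interleaved once more: those of [p] take the even places of the common
    stream, those of [q] the odd places. *)
Lemma definable_share P Q : definable P -> definable Q ->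
  exists p q c, (forall v, P v <-> sat (mix v c) p) /\
                (forall v, Q v <-> sat (mix v c) q).
Proof.
move=> [p [c Hp]] [q [d Hq]].
exists (rename (fun n => if odd n then n./2.*2.*2.+1 else n) p).
exists (rename (fun n => if odd n then n./2.*2.+1.*2.+1 else n) q).
exists (mix c d); split=> v; rewrite ?Hp ?Hq sat_rename.
  suff -> : (fun n => mix v (mix c d) (if odd n then n./2.*2.*2.+1 else n))
            = mix v c by [].
  by apply: funext => n; case: ifP => o; rewrite ?mix_odd ?mix_even /mix o.
suff -> : (fun n => mix v (mix c d) (if odd n then n./2.*2.+1.*2.+1 else n))
          = mix v d by [].
by apply: funext => n; case: ifP => o; rewrite ?mix_odd ?mix_even /mix o.
Qed.

Lemma definable_not P : definable P -> definable (fun v => ~ P v).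
Proof. by move=> [p [c H]]; exists (FNot p), c => v; rewrite /= H. Qed.

Lemma definable_and P Q : definable P -> definable Q ->
  definable (fun v => P v /\ Q v).
Proof.
move=> /definable_share HP /HP [p [q [c [Hp Hq]]]].
by exists (FAnd p q), c => v; rewrite /= Hp Hq.
Qed.

Lemma definable_or P Q : definable P -> definable Q ->
  definable (fun v => P v \/ Q v).
Proof.
move=> /definable_share HP /HP [p [q [c [Hp Hq]]]].
by exists (FOr p q), c => v; rewrite /= Hp Hq.
Qed.

Lemma definable_imp P Q : definable P -> definable Q ->
  definable (fun v => P v -> Q v).
Proof.
move=> /definable_share HP /HP [p [q [c [Hp Hq]]]].
by exists (FImp p q), c => v; rewrite /= Hp Hq.
Qed.

Lemma definable_iff P Q : definable P -> definable Q ->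
  definable (fun v => P v <-> Q v).
Proof.
by move=> dP dQ; apply: definable_and; apply: definable_imp.
Qed.

(** A quantifier inserts the new element at raw index 0, which exchanges the parities of variables
    and parameters; this renaming restores the layout. *)
Lemma mix_extend v c x :
  (fun n => extend x (mix v c) (if odd n then n.+1 else n.-1)) =
  mix (extend x v) c.
Proof.
apply: funext => n; rewrite -(odd_double_half n); case: (odd n) => /=.
  by rewrite !add1n /= odd_double /= mix_odd mix_odd.
rewrite add0n odd_double mix_even; case: n./2 => [|m] //.
by rewrite doubleS -[RHS](mix_even v c).
Qed.

Lemma definable_all (P : (nat -> M) -> M -> Prop) :
  definable (fun v => P (fun n => v n.+1) (v 0)) ->
  definable (fun v => forall x, P v x).
Proof.
move=> [p [c H]].
exists (FAll (rename (fun n => if odd n then n.+1 else n.-1) p)), c => v /=.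
by split=> HP x; have := HP x; rewrite sat_rename mix_extend -(H (extend x v)).
Qed.

Lemma definable_ex (P : (nat -> M) -> M -> Prop) :
  definable (fun v => P (fun n => v n.+1) (v 0)) ->
  definable (fun v => exists x, P v x).
Proof.
move=> [p [c H]].
exists (FEx (rename (fun n => if odd n then n.+1 else n.-1) p)), c => v /=.
by split=> -[x HP]; exists x; move: HP;
  rewrite sat_rename mix_extend -(H (extend x v)).
Qed.

Lemma definable_rename P (r : nat -> nat) :
  definable P -> definable (fun v => P (fun n => v (r n))).
Proof.
move=> [p [c H]].
exists (rename (fun n => if odd n then n else (r n./2).*2) p), c => v.
rewrite H sat_rename.
suff -> : (fun n => mix v c (if odd n then n else (r n./2).*2)) =
          mix (fun n => v (r n)) c by [].
by apply: funext => n; case: ifP => o; rewrite ?mix_even // /mix o.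
Qed.

Lemma def_term_rename (t : (nat -> M) -> M) (r : nat -> nat) :
  def_term t -> def_term (fun v => t (fun n => v (r n))).
Proof. by move=> /(definable_rename (up r)). Qed.

(** The bridge from Rocq predicates to sets of the model. [Q] sees a single variable, so every even
    index may be sent to the element being tested and the odd ones to the parameters. *)
Lemma separation {hZF : ZF M} (Q : M -> Prop) (a : M) :
  definable (fun v => Q (v 0)) -> exists b, forall x, x ∈ b <-> x ∈ a /\ Q x.
Proof.
move=> [p [c H]].
have [b Hb] := zf_separation hZF
  (rename (fun n => if odd n then n./2.+1 else 0) p) c a.
exists b => x; rewrite Hb sat_rename (H (fun=> x)).
suff -> : (fun n => extend x c (if odd n then n./2.+1 else 0)) = mix (fun=> x) c.
  by [].
by apply: funext => n; rewrite /mix; case: ifP.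
Qed.

Context {hZF : ZF M}.

(** Environments are total functions on [nat], so even a formula without parameters needs an element
    of the model to fill them. *)
Lemma model_inhabited : exists x : M, True.
Proof. by have [w _] := zf_infinity hZF; exists w. Qed.

Lemma def_term_var n : def_term (fun v => v n).
Proof.
have [a _] := model_inhabited.
by exists (FEq 0 n.+1.*2), (fun=> a) => v; rewrite /= -[0]/(0.*2) !mix_even.
Qed.

Lemma def_term_const a : def_term (fun=> a).
Proof.
by exists (FEq 0 1), (fun=> a) => v; rewrite /= -[0]/(0.*2) mix_even (mix_odd v _ 0).
Qed.

Lemma definable_mem s t : def_term s -> def_term t ->
  definable (fun v => s v ∈ t v).
Proof.
move=> ds dt.
apply: (@definable_ext _ (fun v => exists x y, x = s v /\ y = t v /\ x ∈ y)).
  by move=> v; split=> [H|[x [y [-> [->]]]] //]; exists (s v), (t v).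
apply/definable_ex/definable_ex/definable_and.
  exact: (definable_rename (fun n => n.+1) ds).
apply: definable_and.
  by have := definable_rename (fun n => if n is k.+1 then k.+2 else 0) dt.
have [a _] := model_inhabited.
exists (FMem 2 0), (fun=> a) => v.
by rewrite /= -[0]/(0.*2) -[2]/(1.*2) !mix_even.
Qed.

Lemma definable_eq s t : def_term s -> def_term t ->
  definable (fun v => s v = t v).
Proof.
move=> ds dt.
apply: (@definable_ext _ (fun v => exists x, x = s v /\ x = t v)).
  by move=> v; split=> [H|[x [-> ->]] //]; exists (s v).
exact/definable_ex/definable_and.
Qed.

(** ** Definite description *)

Definition iota_default : M := sval (cid model_inhabited).

Definition the (Q : M -> Prop) : M :=
  match pselect (exists! x, Q x) with
  | left h => sval (cid h)
  | right _ => iota_default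
  end.

Lemma theP (Q : M -> Prop) : (exists! x, Q x) -> Q (the Q).
Proof. by rewrite /the; case: pselect => // h _; case: cid => x []. Qed.

Lemma the_eq (Q : M -> Prop) x : Q x -> (forall y, Q y -> y = x) -> the Q = x.
Proof.
by move=> Qx Qu; apply/Qu/(@theP Q); exists x; split=> // y /Qu ->.
Qed.

(** Where the description fails, the value is one fixed element, which enters the formula as a
    parameter; picking it by choice in the metatheory is therefore harmless. *)
Lemma def_the (Q : (nat -> M) -> M -> Prop) :
  definable (fun v => Q (fun n => v n.+1) (v 0)) ->
  def_term (fun v => the (Q v)).
Proof.
move=> dQ; rewrite /def_term.
pose U (v : nat -> M) x := Q v x /\ forall y, Q v y -> x = y.
apply: (@definable_ext _ (fun v => U (fun n => v n.+1) (v 0) \/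
   ~ (exists x, U (fun n => v n.+1) x) /\ v 0 = iota_default)).
  move=> v; rewrite /the; case: pselect => [h|h].
    case: cid => x /= Ux; split=> [->|[[_ ]|[[]]]]; last by exists x.
      by left.
    by move=> /(_ x Ux.1).
  by split=> [|[Ux|[_ ->]]] //; [right | case: h; exists (v 0)].
have dU (r : nat -> nat) (i : nat) :
  definable (fun v => U (fun n => v (r n)) (v i)).
  apply: definable_and.
    exact: (definable_rename (fun n => if n is k.+1 then r k else i) dQ).
  apply/definable_all/definable_imp.
    exact: (definable_rename (fun n => if n is k.+1 then (r k).+1 else 0) dQ).
  by apply: definable_eq; apply: def_term_var.
apply: definable_or; first exact: dU.
apply: definable_and.
  by apply/definable_not/definable_ex; exact: (dU (fun n => n.+2) 0).
by apply: definable_eq; [apply: def_term_var | apply: def_term_const].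
Qed.

End Definability.

(* Redefined each time a definable operation is introduced. *)
Ltac def_operation := fail.

Ltac def_step :=
  cbv beta;
  first
  [ assumption
  | match goal with
    | |- def_term (fun v => v ?n) => apply: def_term_var
    | |- def_term (fun _ => ?a) => apply: def_term_const
    | |- def_term (fun v => ?s (fun n => v (@?r n))) => apply: (@def_term_rename _ s r)
    | |- def_term (fun v => the _) => apply: def_the
    | H : definable_rel ?P |- definable (fun v => ?P (@?s v) (@?t v)) => apply: H
    | |- definable (fun v => @?P v <-> @?Q v) => apply: definable_iff
    | |- definable (fun v => @?P v /\ @?Q v) => apply: definable_and
    | |- definable (fun v => @?P v \/ @?Q v) => apply: definable_or
    | |- definable (fun v => ~ @?P v) => apply: definable_not
    | |- definable (fun v => @mem _ _ _) => apply: definable_mem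
    | |- definable (fun v => @eq (univ _) _ _) => apply: definable_eq
    | |- definable (fun v => exists x : univ _, @?P v x) => apply: definable_ex
    | |- definable (fun v => @?P v -> @?Q v) => apply: definable_imp
    | |- definable (fun v => forall x : univ _, @?P v x) => apply: definable_all
    end
  | def_operation
  | progress (rewrite /is_opair /is_upair /is_empty /is_succ /inductive_set /elts
       /subclass /same_class /cprod /app /app2 /omega /interior /closed_set
       /closure /unique /dist /conj_dist /Defs.le /Defs.lt /maps /sum /prd
       /is_pow2inv) ].

Ltac definability := repeat def_step.

(** * Pairs, functions and natural numbers of the model *)

Section Sets.
Context {M : interp} {hZF : ZF M}.
Implicit Types (a b f x y z p : M) (s t : (nat -> M) -> M).

Lemma upair_exists x y : exists p : M, is_upair p x y.
Proof. exact: zf_pairing hZF x y. Qed.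

Lemma upair_unique p q x y : is_upair p x y -> is_upair q x y -> p = q.
Proof. by move=> hp hq; apply: (zf_extensionality hZF) => z; rewrite hp hq. Qed.

Definition pair x y : M := the (fun p => is_opair p x y).

Lemma def_pair s t : def_term s -> def_term t ->
  def_term (fun v => pair (s v) (t v)).
Proof. by move=> ds dt; rewrite /pair; definability. Qed.

Lemma opairP p x y : is_opair p x y <-> p = pair x y.
Proof.
have uq q q' : is_opair q x y -> is_opair q' x y -> q = q'.
  move=> [a [b [ha [hb hq]]]] [a' [b' [ha' [hb' hq']]]].
  move: hq'; rewrite (upair_unique ha' ha) (upair_unique hb' hb).
  exact: upair_unique.
have ex : is_opair (pair x y) x y.
  have [a ha] := upair_exists x x; have [b hb] := upair_exists x y.
  have [q hq] := upair_exists a b; have hqq : is_opair q x y by exists a, b.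
  by apply: (@theP _ _ (fun p => is_opair p x y)); exists q; split=> // q'; apply: uq.
by split=> [/uq|->] //; apply.
Qed.

Lemma pair_inj x y x' y' : pair x y = pair x' y' -> x = x' /\ y = y'.
Proof.
move=> e; have /opairP [a' [b' [ha' [hb' hp']]]] := e.
have /opairP [a [b [ha [hb hp]]]] := erefl (pair x y).
have sing q z w : is_upair q z z -> w ∈ q -> w = z by move=> hq /hq [].
have xx' : x = x'.
  have : a' ∈ pair x y by apply/hp'; left.
  move=> /hp [aa|ab]; first by apply/esym/(sing _ _ _ ha); rewrite -aa ha'; left.
  by apply: (sing _ _ _ ha'); rewrite ab hb; left.
subst x'; split=> //.
have : b' ∈ pair x y by apply/hp'; right.
have : b ∈ pair x y by apply/hp; right.
move=> /hp' [ba|bb] /hp [b'a|b'b].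
- have -> : y = x by apply: (sing _ _ _ ha'); rewrite -ba hb; right.
  by apply/esym/(sing _ _ _ ha); rewrite -b'a hb'; right.
- have -> : y = x by apply: (sing _ _ _ ha'); rewrite -ba hb; right.
  by apply/esym/(sing _ _ _ ha'); rewrite -ba -b'b hb'; right.
- have y'x : y' = x by apply: (sing _ _ _ ha); rewrite -b'a hb'; right.
  by have /hb' [->|//] : y ∈ b' by [rewrite -bb hb; right].
- have /hb [y'x|//] : y' ∈ b by rewrite -b'b hb'; right.
  by have /hb' [->|//] : y ∈ b' by [rewrite -bb hb; right].
Qed.

Lemma appE f x y : app f x y <-> pair x y ∈ f.
Proof.
by split=> [[p [/opairP -> ]]|H] //; exists (pair x y); split=> //; apply/opairP.
Qed.

Lemma app2E f x y z : app2 f x y z <-> pair (pair x y) z ∈ f.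
Proof.
split=> [[p [/opairP -> /appE]]|H] //.
by exists (pair x y); split; [apply/opairP | apply/appE].
Qed.

Lemma cprodE (A B : class M) p :
  cprod A B p <-> exists x y, A x /\ B y /\ p = pair x y.
Proof.
by split=> -[x [y [? [? /opairP ?]]]]; exists x, y.
Qed.

Lemma product_exists a b : exists c, forall p, p ∈ c <-> cprod (elts a) (elts b) p.
Proof.
have [ab hab] := upair_exists a b.
have [u hu] := zf_union hZF ab.
(* A Kuratowski pair of elements of [u] is a set of subsets of [u], so it lies in the double power
   set. *)
have [pu hpu] := zf_powerset hZF u; have [ppu hppu] := zf_powerset hZF pu.
have [|c hc] := @separation _ _ (cprod (elts a) (elts b)) ppu; first by definability.
exists c => p; rewrite hc; split=> [[]|] // H; split=> //.
have [x [y [hx [hy [q [r [hq [hr hp]]]]]]]] := H.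
have xu : x ∈ u by apply/hu; exists a; split=> //; apply/hab; left.
have yu : y ∈ u by apply/hu; exists b; split=> //; apply/hab; right.
apply/hppu => z /hp [] ->; apply/hpu => w.
  by move=> /hq [] ->.
by move=> /hr [] ->.
Qed.

(** The functions of the model constructed later are all carved out of a product in this way, as
    graphs of definable relations. *)
Lemma relation_exists a b (Q : M -> M -> Prop) :
  definable (fun v => Q (v 1) (v 0)) ->
  exists f, elts f ⊆ cprod (elts a) (elts b) /\
    forall x y, app f x y <-> x ∈ a /\ y ∈ b /\ Q x y.
Proof.
move=> dQ; have [c hc] := product_exists a b.
have [|f hf] := @separation _ _ (fun p => exists x y, p = pair x y /\ Q x y) c.
  apply/definable_ex/definable_ex/definable_and; last first.
    exact: (definable_rename id dQ).
  by apply: definable_eq; [|apply: def_pair]; definability.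
exists f; split=> [p /hf [/hc] //|x y].
rewrite appE hf hc cprodE; split.
  by move=> [[x' [y' [? [? /pair_inj [-> ->]]]]] [? [? [/pair_inj [<- <-] ?]]]].
by move=> [? [? ?]]; split; exists x, y.
Qed.

Lemma mem_irrefl x : x ∉ x.
Proof.
move=> xx; have [p hp] := upair_exists x x.
have [|y [/hp hy H]] := zf_foundation hZF (x := p); first by exists x; apply/hp; left.
by have yx : y = x by [case: hy]; apply: (H x); [apply/hp; left | rewrite yx].
Qed.

Lemma mem_asym x y : x ∈ y -> y ∉ x.
Proof.
move=> xy yx; have [p hp] := upair_exists x y.
have [|z [/hp hz H]] := zf_foundation hZF (x := p); first by exists x; apply/hp; left.
by case: hz H => -> H; [apply: (H y) | apply: (H x)]; rewrite ?hp; tauto.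
Qed.

Definition emptyset : M := the (@is_empty M).

Lemma emptysetP : is_empty emptyset.
Proof.
have [w [[e [he _]] _]] := zf_infinity hZF.
apply: (@theP _ _ (@is_empty M)); exists e; split=> // e' he'.
by apply: (zf_extensionality hZF) => z; split=> [/he|/he'].
Qed.

Lemma emptyset_eq e : is_empty e -> e = emptyset.
Proof.
move=> he; apply: (zf_extensionality hZF) => z.
by split=> [/he|/emptysetP].
Qed.

Definition succ x : M := the (fun y => is_succ y x).

Lemma def_succ s : def_term s -> def_term (fun v => succ (s v)).
Proof. by move=> ds; rewrite /succ; definability. Qed.

End Sets.

Ltac def_set_operation :=
  match goal with
  | |- def_term (fun v => pair _ _) => apply: def_pair
  | |- def_term (fun v => succ _) => apply: def_succ
  end.
Ltac def_operation ::= def_set_operation.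

Section Omega.
Context {M : interp} {hZF : ZF M}.
Implicit Types (a b f x y z p : M).

Lemma succP x : is_succ (succ x) x.
Proof.
have [sx hs] := upair_exists x x; have [p hp] := upair_exists x sx.
have [u hu] := zf_union hZF p.
have h : is_succ u x.
  move=> z; rewrite hu; split=> [[y [/hp [] -> ]]|]; first by left.
    by move=> /hs [] ->; right.
  case=> [zx|->]; first by exists x; rewrite hp; split=> //; left.
  by exists sx; rewrite hp hs; split; [right | left].
apply: (@theP _ _ (fun y => is_succ y x)); exists u; split=> // u' hu'.
by apply: (zf_extensionality hZF) => z; rewrite h hu'.
Qed.

Lemma succ_eq y x : is_succ y x -> y = succ x.
Proof. by move=> h; apply: (zf_extensionality hZF) => z; rewrite h (succP x). Qed.

(** Foundation excludes a membership cycle between [x] and [y], so this holds for arbitrary sets and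
    not just for natural numbers. *)
Lemma succ_inj x y : succ x = succ y -> x = y.
Proof.
move=> e.
have /(succP y) [xy|//] : x ∈ succ y by rewrite -e; apply/succP; right.
have /(succP x) [yx|//] : y ∈ succ x by rewrite e; apply/succP; right.
by case: (mem_asym xy yx).
Qed.

Lemma succ_neq0 x : succ x <> emptyset.
Proof. by move=> e; apply: (emptysetP (z := x)); rewrite -e; apply/succP; right. Qed.

Lemma inductive_setP (w : M) : inductive_set w <->
  emptyset ∈ w /\ forall x, x ∈ w -> succ x ∈ w.
Proof.
split=> [[[e [/emptyset_eq -> ?]] H]|[w0 H]]; split=> //.
- by move=> x /H [s [/succ_eq ->]].
- by exists emptyset; split=> //; apply: emptysetP.
- by move=> x /H xw; exists (succ x); split=> //; apply: succP.
Qed.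

Lemma omega0 : omega emptyset.
Proof. by move=> w /inductive_setP []. Qed.

Lemma omegaS n : omega n -> omega (succ n).
Proof. by move=> hn w hw; have /inductive_setP [_] := hw; apply; apply: hn. Qed.

(** [omega] is the intersection of the inductive sets of the model, so induction reaches only
    predicates that cut out a set. *)
Lemma omega_ind (P : M -> Prop) : definable (fun v => P (v 0)) ->
  P emptyset -> (forall n, omega n -> P n -> P (succ n)) ->
  forall n, omega n -> P n.
Proof.
move=> dP P0 PS n hn; have [w hw] := zf_infinity hZF.
have [|b hb] := @separation _ _ (fun x => omega x /\ P x) w; first by definability.
have /hb [_ [_ //]] : n ∈ b.
apply: hn; apply/inductive_setP; have /inductive_setP [w0 wS] := hw.
split=> [|x]; rewrite !hb; first by have := omega0.
by move=> [/wS ? [? ?]]; split=> //; split; [apply: omegaS | apply: PS].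
Qed.

Lemma omega_set_exists : exists w : M, forall n, n ∈ w <-> omega n.
Proof.
have [w hw] := zf_infinity hZF.
have [|b hb] := @separation _ _ (@omega M) w; first by definability.
by exists b => n; rewrite hb; split=> [[]|hn] //; split=> //; apply: hn.
Qed.

Lemma omega_trans (n : M) : omega n ->
  forall k, k ∈ n -> omega k /\ elts k ⊆ elts n.
Proof.
move: n; apply: omega_ind; first by definability.
  by move=> k /emptysetP.
move=> n hn IH k /succP [/IH [? sub]|->]; split=> // x.
  by move=> /sub ?; apply/succP; left.
by move=> ?; apply/succP; left.
Qed.

Lemma omega_succ_le (n : M) : omega n ->
  forall k, k ∈ n -> succ k = n \/ succ k ∈ n.
Proof.
move: n; apply: omega_ind; first by definability.
  by move=> k /emptysetP.
move=> n hn IH k /succP [/IH [<-|]|->]; last by left.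
  by right; apply/succP; right.
by right; apply/succP; left.
Qed.

Lemma omega_total (n m : M) : omega n -> omega m -> m ∈ n \/ m = n \/ n ∈ m.
Proof.
move=> hn hm; move: n hn; apply: omega_ind; first by definability.
  move: m hm; apply: omega_ind; first by definability.
    by right; left.
  move=> m _ [/emptysetP //|H]; right; right; apply/succP.
  by case: H => [->|]; [right | left].
move=> n hn [H|[->|H]].
- by left; apply/succP; left.
- by left; apply/succP; right.
- by right; case: (omega_succ_le hm H) => [->|]; [left | right].
Qed.

(** Foundation, applied to the set of solutions, gives a minimal one for membership, and trichotomy
    makes it least. *)
Lemma omega_least (P : M -> Prop) : definable (fun v => P (v 0)) ->
  (exists n, omega n /\ P n) ->
  exists n, omega n /\ P n /\ forall m, omega m -> P m -> m = n \/ n ∈ m.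
Proof.
move=> dP [n [hn Pn]]; have [w hw] := omega_set_exists.
have [//|b hb] := @separation _ _ P w.
have [|m [/hb [/hw hm Pm] H]] := zf_foundation hZF (x := b).
  by exists n; apply/hb; rewrite hw.
exists m; split=> //; split=> // k hk Pk.
have [km|] := omega_total hm hk; last by [].
by case: (H k _ km); apply/hb; rewrite hw.
Qed.

End Omega.

Existing Class real_line.

(** * The real numbers of the model as an ordered field *)

(** The proofs [hZF] and [hR] are arguments of the type so that the algebraic structures attached to
    it can be inferred from the type alone. *)
Definition real (M : interp) (hZF : ZF M) (R : ofield M) (hR : real_line R) : Type :=
  {x : M | x ∈ car R}.

Section Reals.
Context {M : interp} {hZF : ZF M} {R : ofield M} {hR : real_line R}.
Local Notation K := (real hZF hR).

Definition real_val (r : K) : M := sval r.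

Definition to_real (x : M) : K :=
  match pselect (x ∈ car R) with
  | left h => exist _ x h
  | right _ => exist _ (zero R) (rl_zero hR)
  end.

Lemma real_valP (r : K) : real_val r ∈ car R.
Proof. by case: r. Qed.

Lemma real_val_inj : injective real_val.
Proof. by move=> [x hx] [y hy] /= e; subst y; congr exist; exact: Prop_irrelevance. Qed.

Lemma to_realK x : x ∈ car R -> real_val (to_real x) = x.
Proof. by rewrite /to_real; case: pselect. Qed.

Lemma real_valK (r : K) : to_real (real_val r) = r.
Proof. by apply/real_val_inj; rewrite to_realK //; apply: real_valP. Qed.

Lemma app2_dom (f x y z : M) (A B C : class M) : maps f (cprod A B) C ->
  app2 f x y z -> A x /\ B y /\ C z.
Proof.
move=> [hf _] /app2E /hf /cprodE [p [c [/cprodE [a [b [Aa [Bb ->]]]] [Cc]]]].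
by move=> /pair_inj [/pair_inj [-> ->] ->].
Qed.

Lemma app2_total (f x y : M) (A B C : class M) : maps f (cprod A B) C -> A x -> B y ->
  exists! z, app2 f x y z.
Proof.
move=> [hf tot] Ax By.
have [|z [hz uz]] := tot (pair x y); first by apply/cprodE; exists x, y.
exists z; split; first by apply/app2E/appE.
by move=> z' /app2E/appE/uz.
Qed.

Definition real_add (x y : K) : K :=
  to_real (the (fun z => sum R (real_val x) (real_val y) z)).
Definition real_mul (x y : K) : K :=
  to_real (the (fun z => prd R (real_val x) (real_val y) z)).
Definition real_opp (x : K) : K :=
  to_real (the (fun y => sum R (real_val x) y (zero R))).
Definition real_inv (x : K) : K :=
  match pselect (real_val x = zero R) with
  | left _ => x
  | right _ => to_real (the (fun y => prd R (real_val x) y (one R)))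
  end.
Definition real_le (x y : K) : bool := `[< le R (real_val x) (real_val y) >].

Lemma real_addP x y z :
  sum R (real_val x) (real_val y) z <-> z = real_val (real_add x y).
Proof.
have [z0 [h0 u0]] := app2_total (rl_add hR) (real_valP x) (real_valP y).
have e : the (fun z => sum R (real_val x) (real_val y) z) = z0.
  by apply: the_eq => // z' /u0.
have [_ [_ c0]] := app2_dom (rl_add hR) h0.
by rewrite /real_add e to_realK //; split=> [/u0|->].
Qed.

Lemma real_mulP x y z :
  prd R (real_val x) (real_val y) z <-> z = real_val (real_mul x y).
Proof.
have [z0 [h0 u0]] := app2_total (rl_mul hR) (real_valP x) (real_valP y).
have e : the (fun z => prd R (real_val x) (real_val y) z) = z0.
  by apply: the_eq => // z' /u0.
have [_ [_ c0]] := app2_dom (rl_mul hR) h0.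
by rewrite /real_mul e to_realK //; split=> [/u0|->].
Qed.

Lemma real_leP x y : reflect (le R (real_val x) (real_val y)) (real_le x y).
Proof. exact: asboolP. Qed.

Definition real_zero : K := exist _ (zero R) (rl_zero hR).
Definition real_one : K := exist _ (one R) (rl_one hR).

Lemma real_addA : associative real_add.
Proof.
move=> x y z; apply: real_val_inj.
have xy : sum R (real_val x) (real_val y) (real_val (real_add x y)) by apply/real_addP.
have yz : sum R (real_val y) (real_val z) (real_val (real_add y z)) by apply/real_addP.
by apply/real_addP/(rl_addA hR _ xy yz)/real_addP.
Qed.

Lemma real_addC : commutative real_add.
Proof. by move=> x y; apply/real_val_inj/real_addP/(rl_addC hR)/real_addP. Qed.

Lemma real_add0 : left_id real_zero real_add.
Proof. by move=> x; apply/esym/real_val_inj/real_addP/(rl_add0 hR)/real_valP. Qed.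

(** The axiom gives existence only; the uniqueness required by [the] is cancellation in the
    group. *)
Lemma real_addNP x : real_add x (real_opp x) = real_zero.
Proof.
apply/esym/real_val_inj/real_addP.
have [y hy] := rl_opp hR (real_valP x).
have [_ [yR _]] := app2_dom (rl_add hR) hy.
have e : the (fun y => sum R (real_val x) y (zero R)) = y; last first.
  by rewrite /real_opp e to_realK.
apply: the_eq => // y' hy'; have [_ [yR' _]] := app2_dom (rl_add hR) hy'.
move: hy hy'; rewrite -(to_realK yR) -(to_realK yR').
move: (to_real y) (to_real y') => z z' hz hz'; congr real_val.
have {}hz : real_zero = real_add x z by apply/real_val_inj/real_addP.
have {}hz' : real_zero = real_add x z' by apply/real_val_inj/real_addP.
by rewrite -(real_add0 z') hz (real_addC x) -real_addA -hz' real_addC real_add0.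
Qed.

Lemma real_addN : left_inverse real_zero real_opp real_add.
Proof. by move=> x; rewrite real_addC real_addNP. Qed.

(** The algebraic hierarchy asks for decidable equality and a choice operator. Both are taken in the
    metatheory, and neither ever defines a set of the model. *)
HB.instance Definition _ := gen_eqMixin K.
HB.instance Definition _ := gen_choiceMixin K.
HB.instance Definition _ :=
  GRing.isZmodule.Build K real_addA real_addC real_add0 real_addN.

Lemma real_mulA : associative real_mul.
Proof.
move=> x y z; apply: real_val_inj.
have xy : prd R (real_val x) (real_val y) (real_val (real_mul x y)) by apply/real_mulP.
have yz : prd R (real_val y) (real_val z) (real_val (real_mul y z)) by apply/real_mulP.
by apply/real_mulP/(rl_mulA hR _ xy yz)/real_mulP.
Qed.

Lemma real_mulC : commutative real_mul.
Proof. by move=> x y; apply/real_val_inj/real_mulP/(rl_mulC hR)/real_mulP. Qed.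

Lemma real_mul1 : left_id real_one real_mul.
Proof. by move=> x; apply/esym/real_val_inj/real_mulP/(rl_mul1 hR)/real_valP. Qed.

Lemma real_mulDl : left_distributive real_mul real_add.
Proof.
move=> x y z; rewrite ![real_mul _ z]real_mulC; apply/esym/real_val_inj/real_mulP.
apply: (rl_distr hR); first exact/real_addP.
- exact/real_mulP.
- exact/real_mulP.
- exact/real_addP.
Qed.

Lemma real_neq01 : real_one != real_zero.
Proof. by apply/eqP => /(congr1 real_val); apply: (rl_neq hR). Qed.

HB.instance Definition _ := GRing.Zmodule_isComNzRing.Build K
  real_mulA real_mulC real_mul1 real_mulDl real_neq01.

Lemma real_mulV (x : K) : x != 0%R -> real_mul (real_inv x) x = 1%R.
Proof.
move=> /eqP x0; have xz : real_val x <> zero R by move=> h; apply/x0/real_val_inj.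
rewrite real_mulC; apply/esym/real_val_inj/real_mulP.
have [y hy] := rl_inv hR (real_valP x) xz.
have [_ [yR _]] := app2_dom (rl_mul hR) hy.
have e : the (fun y => prd R (real_val x) y (one R)) = y; last first.
  by rewrite /real_inv; case: pselect => // _; rewrite e to_realK.
apply: the_eq => // y' hy'; have [_ [yR' _]] := app2_dom (rl_mul hR) hy'.
move: hy hy'; rewrite -(to_realK yR) -(to_realK yR').
move: (to_real y) (to_real y') => z z' hz hz'; congr real_val.
have {}hz : real_one = real_mul x z by apply/real_val_inj/real_mulP.
have {}hz' : real_one = real_mul x z' by apply/real_val_inj/real_mulP.
by rewrite -(real_mul1 z') hz (real_mulC x) -real_mulA -hz' real_mulC real_mul1.
Qed.

Lemma real_inv0 : real_inv 0%R = 0%R.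
Proof. by rewrite /real_inv; case: pselect. Qed.

HB.instance Definition _ := GRing.ComNzRing_isField.Build K real_mulV real_inv0.


Lemma real_sum (x y : K) : sum R (real_val x) (real_val y) (real_val (x + y)%R).
Proof. exact/real_addP. Qed.

Lemma real_prd (x y : K) : prd R (real_val x) (real_val y) (real_val (x * y)%R).
Proof. exact/real_mulP. Qed.

Lemma real_le0_add (x y : K) : real_le 0%R x -> real_le 0%R y -> real_le 0%R (x + y)%R.
Proof.
move=> /real_leP hx /real_leP hy; apply/real_leP; apply: (rl_le_trans hR) hy _.
by have := rl_le_add hR hx (real_sum 0%R y) (real_sum x y); rewrite add0r.
Qed.

Lemma real_le0_mul (x y : K) : real_le 0%R x -> real_le 0%R y -> real_le 0%R (x * y)%R.
Proof.
move=> /real_leP hx /real_leP hy; apply/real_leP.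
by apply: (rl_le_mul hR hx hy); apply/real_mulP.
Qed.

Lemma real_le0_anti (x : K) : real_le 0%R x -> real_le x 0%R -> x = 0%R.
Proof.
by move=> /real_leP hx /real_leP hy; apply/real_val_inj/(rl_le_anti hR).
Qed.

Lemma real_sub_ge0 (x y : K) : real_le 0%R (y - x)%R = real_le x y.
Proof.
apply/real_leP/real_leP => h.
  by have := rl_le_add hR h (real_sum 0%R x) (real_sum _ x); rewrite add0r subrK.
by have := rl_le_add hR h (real_sum _ (- x)%R) (real_sum _ (- x)%R); rewrite subrr.
Qed.

Lemma real_le0_total (x : K) : real_le 0%R x || real_le x 0%R.
Proof.
by apply/orP; case: (rl_le_total hR (real_valP 0%R) (real_valP x)) => H;
  [left | right]; apply/real_leP.
Qed.

Definition real_norm (x : K) : K := if real_le 0%R x then x else (- x)%R.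
Definition real_lt (x y : K) : bool := (y != x) && real_le x y.

Lemma real_normN (x : K) : real_norm (- x)%R = real_norm x.
Proof.
have leN y : real_le 0%R (- y)%R = real_le y 0%R.
  by rewrite -real_sub_ge0 subr0 -(real_sub_ge0 y) sub0r.
rewrite /real_norm leN opprK; case: ifP => h1; case: ifP => h2 //.
  by rewrite (real_le0_anti h2 h1) oppr0.
by move: (real_le0_total x); rewrite h1 h2.
Qed.

Lemma real_ge0_norm (x : K) : real_le 0%R x -> real_norm x = x.
Proof. by rewrite /real_norm => ->. Qed.

Lemma real_lt_def (x y : K) : real_lt x y = (y != x) && real_le x y.
Proof. by []. Qed.

HB.instance Definition _ := Num.IntegralDomain_isLeReal.Build K
  real_le0_add real_le0_mul real_le0_anti real_sub_ge0 real_le0_total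
  real_normN real_ge0_norm real_lt_def.

Lemma real_leE (x y : K) : le R (real_val x) (real_val y) <-> (x <= y)%R.
Proof. by split=> /real_leP. Qed.

Lemma real_ge0E (x : K) : le R (zero R) (real_val x) <-> (0 <= x)%R.
Proof. exact: (real_leE 0%R x). Qed.

Lemma real_ltE (x y : K) : lt R (real_val x) (real_val y) <-> (x < y)%R.
Proof.
rewrite lt_neqAle /lt real_leE; split=> [[-> H]|/andP [/eqP H ->]].
  by rewrite andbT; apply/eqP => e; apply: H; rewrite e.
by split=> // /real_val_inj.
Qed.

Lemma real_gt0E (x : K) : lt R (zero R) (real_val x) <-> (0 < x)%R.
Proof. exact: (real_ltE 0%R x). Qed.

Lemma real_sumE (x y : K) z :
  sum R (real_val x) (real_val y) z <-> z = real_val (x + y)%R.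
Proof. exact: real_addP. Qed.

End Reals.

(** * Recursion on the natural numbers of the model *)

Section Recursion.
Context {M : interp} {hZF : ZF M}.
Implicit Types (n m x y : M).

Lemma def_term_comp (G : M -> M) s : def_term (fun v => G (v 0)) -> def_term s ->
  def_term (fun v : nat -> M => G (s v)).
Proof.
move=> dG ds; rewrite /def_term; apply: (@definable_ext _ _ (fun v =>
  exists x, v 0 = G x /\ x = s (fun k => v k.+1))).
  by move=> v; split=> [->|[x [-> ->]]] //; eexists.
apply/definable_ex/definable_and; last by definability.
exact: (definable_rename (fun k => if k is 0 then 1 else 0) dG).
Qed.

(** The graph is the intersection [H] of all sets that contain the initial pair and are closed under
    the step, which dispenses with finite approximations. Its purpose is the existence of the powers
    2^-n. *)
Lemma recursion (A a0 : M) (G : M -> M) :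
  a0 ∈ A -> (forall x, x ∈ A -> G x ∈ A) -> def_term (fun v => G (v 0)) ->
  exists h, [/\ maps h (@omega M) (elts A), app h emptyset a0 &
    forall n x, omega n -> app h n x -> app h (succ n) (G x)].
Proof.
move=> a0A GA dG; have [w hw] := @omega_set_exists M hZF.
have dGc s : def_term s -> def_term (fun v => G (s v)) by apply: def_term_comp.
have [P hP] := product_exists w A.
have inP n x : pair n x ∈ P <-> omega n /\ x ∈ A.
  rewrite hP cprodE; split=> [[? [? [/hw ? [? /pair_inj [-> ->]]]]] //|[? ?]].
  by exists n, x; rewrite /elts hw.
pose (closed := fun S => pair emptyset a0 ∈ S /\
  forall n x, pair n x ∈ S -> pair (succ n) (G x) ∈ S).
pose (H := fun n x => forall S, closed S -> pair n x ∈ S).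
have Pcl : closed P.
  split=> [|n x /inP [? ?]]; apply/inP; split=> //; first exact: omega0.
    exact: omegaS.
  exact: GA.
have H0 : H emptyset a0 by move=> S [].
have HS n x : H n x -> H (succ n) (G x) by move=> h S [? hS]; apply/hS/h.
have dH s t : def_term s -> def_term t -> definable (fun v => H (s v) (t v)).
  move=> ds dt; rewrite /H /closed; definability; apply: dGc; definability.
have Hinv n y : H n y -> (n = emptyset /\ y = a0) \/
    exists m z, H m z /\ n = succ m /\ y = G z.
  (* Inversion comes from minimality: the pairs of [H] that are initial or produced by a step
     already form a closed set. *)
  pose (I := fun n y => (n = emptyset /\ y = a0) \/
    exists m z, H m z /\ n = succ m /\ y = G z).
  have [|S hS] := @separation _ _
      (fun p => exists n y, p = pair n y /\ H n y /\ I n y) P.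
    by rewrite /I; definability; first [apply: dH | apply: dGc]; definability.
  move=> Hny; have /hS : pair n y ∈ S; last first.
    by move=> [_ [? [? [/pair_inj [<- <-] [_ //]]]]].
  apply: Hny; split=> [|m x /hS [mP [n' [x' [/pair_inj [<- <-] [h _]]]]]];
    apply/hS; split.
  - by apply Pcl.
  - by exists emptyset, a0; split=> //; split=> //; left.
  - by apply Pcl.
  - exists (succ m), (G x); split=> //; split; first exact: HS.
    by right; exists m, x.
have Hun n : omega n -> exists x, H n x /\ forall y, H n y -> y = x.
  move: n; apply: omega_ind.
  - by definability; apply: dH; definability.
  - exists a0; split=> // y /Hinv [[]|[m [z [_ [/esym/succ_neq0]]]]] //.
  - move=> n _ [x [Hx ux]]; exists (G x); split; first exact: HS.
    move=> y /Hinv [[/succ_neq0]|[m [z [Hz [/succ_inj nm ->]]]]] //.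
    by rewrite (ux z) // nm.
have [|h [hsub hh]] := @relation_exists _ _ w A H; first by apply: dH; definability.
have {}hh n x : app h n x <-> H n x.
  rewrite hh; split=> [[_ []]|Hx] //.
  by have /inP [/hw ? ?] := Hx P Pcl.
exists h; split; last by move=> n x _ /hh /HS /hh.
  split=> [p /hsub /cprodE [n [x [/hw nw [? ?]]]]|n /Hun [x [Hx ux]]].
    by apply/cprodE; exists n, x.
  by exists x; split=> [|y /hh /ux ->] //; apply/hh.
exact/hh.
Qed.

End Recursion.

(** * Definability of the field operations *)

Section DefinableReals.
Context {M : interp} {hZF : ZF M} {R : ofield M} {hR : real_line R}.
Local Notation K := (real hZF hR).
Local Open Scope ring_scope.
Implicit Types s t : (nat -> M) -> K.

Lemma def_real_rename s (r : nat -> nat) : def_term (fun v => real_val (s v)) ->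
  def_term (fun v => real_val (s (fun n => v (r n)))).
Proof. exact: def_term_rename. Qed.

Lemma def_to_real (s : (nat -> M) -> M) : def_term s ->
  def_term (fun v => real_val (to_real (s v) : K)).
Proof.
move=> ds; rewrite /def_term; apply: (@definable_ext _ _ (fun v =>
  (s (fun n => v n.+1) ∈ car R /\ v 0%N = s (fun n => v n.+1)) \/
  (s (fun n => v n.+1) ∉ car R /\ v 0%N = zero R))); last by definability.
move=> v; rewrite /to_real; case: pselect => h /=; first by tauto.
by tauto.
Qed.

Lemma def_real_add s t : def_term (fun v => real_val (s v)) ->
  def_term (fun v => real_val (t v)) -> def_term (fun v => real_val (s v + t v)).
Proof.
move=> ds dt; rewrite /def_term; apply: (@definable_ext _ _ (fun v =>
  sum R (real_val (s (fun n => v n.+1))) (real_val (t (fun n => v n.+1))) (v 0%N)));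
  first by move=> v; rewrite real_addP.
rewrite /sum; definability; exact: def_real_rename.
Qed.

Lemma def_real_mul s t : def_term (fun v => real_val (s v)) ->
  def_term (fun v => real_val (t v)) -> def_term (fun v => real_val (s v * t v)).
Proof.
move=> ds dt; rewrite /def_term; apply: (@definable_ext _ _ (fun v =>
  prd R (real_val (s (fun n => v n.+1))) (real_val (t (fun n => v n.+1))) (v 0%N)));
  first by move=> v; rewrite real_mulP.
rewrite /prd; definability; exact: def_real_rename.
Qed.

Lemma def_real_opp s : def_term (fun v => real_val (s v)) ->
  def_term (fun v => real_val (- s v)).
Proof.
move=> ds; rewrite /def_term; apply: (@definable_ext _ _ (fun v =>
  sum R (real_val (s (fun n => v n.+1))) (v 0%N) (zero R))).
  move=> v; split=> [->|h].
    by have := real_sum (s (fun n => v n.+1)) (- s (fun n => v n.+1)); rewrite subrr.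
  have [_ [/to_realK e _]] := app2_dom (rl_add hR) h.
  move: h; rewrite -e => /real_addP h.
  have {}h : 0 = s (fun n => v n.+1) + to_real (v 0%N) by exact/real_val_inj.
  congr real_val; apply/eqP; rewrite -addr_eq0 addrC; exact/eqP/esym.
rewrite /sum; definability; exact: def_real_rename.
Qed.

Lemma def_real_inv s : def_term (fun v => real_val (s v)) ->
  def_term (fun v => real_val (s v)^-1).
Proof.
move=> ds; rewrite /def_term; apply: (@definable_ext _ _ (fun v =>
  (real_val (s (fun n => v n.+1)) = zero R /\ v 0%N = zero R) \/
  (real_val (s (fun n => v n.+1)) <> zero R /\
   prd R (real_val (s (fun n => v n.+1))) (v 0%N) (one R)))); last first.
  by rewrite /prd; definability; exact: def_real_rename.
move=> v; set x := s _; have [x0|x0] := eqVneq x 0.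
  rewrite x0 invr0; split=> [->|[[]|[]]] //; by left.
have xz : real_val x <> zero R by move=> e; case/eqP: x0; apply: real_val_inj.
split=> [->|[[]//|[_ h]]].
  by right; split=> //; have := real_prd x x^-1; rewrite mulfV.
have [_ [/to_realK e _]] := app2_dom (rl_mul hR) h.
move: h; rewrite -e => /real_mulP h.
have {}h : 1 = x * to_real (v 0%N) by exact/real_val_inj.
by congr real_val; apply: (mulfI x0); rewrite mulfV // h.
Qed.

Lemma definable_real_le s t : def_term (fun v => real_val (s v)) ->
  def_term (fun v => real_val (t v)) -> definable (fun v => s v <= t v).
Proof.
move=> ds dt; apply: (@definable_ext _ _ (fun v =>
  Defs.le R (real_val (s v)) (real_val (t v)))).
  by move=> v; rewrite real_leE.
by definability; apply: def_real_rename.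
Qed.

Lemma definable_real_lt s t : def_term (fun v => real_val (s v)) ->
  def_term (fun v => real_val (t v)) -> definable (fun v => s v < t v).
Proof.
move=> ds dt; apply: (@definable_ext _ _ (fun v =>
  Defs.lt R (real_val (s v)) (real_val (t v)))).
  by move=> v; rewrite real_ltE.
by definability; apply: def_real_rename.
Qed.

Lemma definable_real_eq s t : def_term (fun v => real_val (s v)) ->
  def_term (fun v => real_val (t v)) -> definable (fun v => s v = t v).
Proof.
move=> ds dt; apply: (@definable_ext _ _ (fun v => real_val (s v) = real_val (t v))).
  by move=> v; split=> [->|/real_val_inj].
by definability.
Qed.

(** Quantification over [K] becomes quantification over the model because [to_real] is onto; its
    default value only repeats zero. *)
Lemma definable_real_all (P : (nat -> M) -> K -> Prop) :
  definable (fun v => P (fun n => v n.+1) (to_real (v 0%N))) ->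
  definable (fun v => forall r : K, P v r).
Proof.
move=> dP; have := definable_all (P := fun v x => P v (to_real x)) dP.
apply: definable_ext => v.
by split=> [H x|H r]; [apply: H | have := H (real_val r); rewrite real_valK].
Qed.

Lemma definable_real_ex (P : (nat -> M) -> K -> Prop) :
  definable (fun v => P (fun n => v n.+1) (to_real (v 0%N))) ->
  definable (fun v => exists r : K, P v r).
Proof.
move=> dP; have := definable_ex (P := fun v x => P v (to_real x)) dP.
apply: definable_ext => v.
by split=> -[x H]; [exists (real_val x); rewrite real_valK | exists (to_real x)].
Qed.

Lemma def_real_if (b : (nat -> M) -> bool) s t : definable (fun v => b v) ->
  def_term (fun v => real_val (s v)) -> def_term (fun v => real_val (t v)) ->
  def_term (fun v => real_val (if b v then s v else t v)).
Proof.
move=> db ds dt; rewrite /def_term; apply: (@definable_ext _ _ (fun v =>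
  (b (fun n => v n.+1) /\ v 0%N = real_val (s (fun n => v n.+1))) \/
  (~ b (fun n => v n.+1) /\ v 0%N = real_val (t (fun n => v n.+1))))).
  by move=> v; case: (b _); split=> [|[[]|[]]] //; [left | right].
have db' := definable_rename (fun n => n.+1) db.
by definability; exact: def_real_rename.
Qed.

(** The restriction to [car R] matters: [to_real] sends everything outside to zero, which would
    spoil uniqueness whenever zero satisfies [Q]. *)
Definition the_real (Q : K -> Prop) : K :=
  to_real (the (fun x => x ∈ car R /\ Q (to_real x))).

Lemma the_realP (Q : K -> Prop) : (exists! r, Q r) -> Q (the_real Q).
Proof.
move=> [r [Qr ur]]; have [|_ //] := @theP _ _ (fun x => x ∈ car R /\ Q (to_real x)).
exists (real_val r); split; first by rewrite real_valK; split=> //; apply: real_valP.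
by move=> x [xR /ur ->]; rewrite to_realK.
Qed.

Lemma the_real_eq (Q : K -> Prop) r :
  Q r -> (forall r', Q r' -> r' = r) -> the_real Q = r.
Proof. by move=> Qr u; apply/u/(@the_realP Q); exists r; split=> // r' /u. Qed.

Lemma def_the_real (Q : (nat -> M) -> K -> Prop) :
  definable (fun v => Q (fun n => v n.+1) (to_real (v 0%N))) ->
  def_term (fun v => real_val (the_real (Q v))).
Proof.
by move=> dQ; apply: def_to_real; definability.
Qed.

End DefinableReals.

Ltac def_field_operation :=
  match goal with
  | |- def_term (fun v => real_val (?s (fun n => v (@?r n)))) =>
      apply: (@def_real_rename _ _ _ _ s r)
  | |- def_term (fun v => real_val (to_real _)) => apply: def_to_real
  | |- def_term (fun v => real_val (@GRing.add _ _ _)) => apply: def_real_add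
  | |- def_term (fun v => real_val (@GRing.mul _ _ _)) => apply: def_real_mul
  | |- def_term (fun v => real_val (@GRing.opp _ _)) => apply: def_real_opp
  | |- def_term (fun v => real_val (@GRing.inv _ _)) => apply: def_real_inv
  | |- def_term (fun v => real_val (the_real _)) => apply: def_the_real
  | |- def_term (fun v => real_val (if _ then _ else _)) => apply: def_real_if
  | |- definable (fun v => is_true (@Order.le _ _ _ _)) => apply: definable_real_le
  | |- definable (fun v => is_true (@Order.lt _ _ _ _)) => apply: definable_real_lt
  | |- definable (fun v => @eq (real _ _) _ _) => apply: definable_real_eq
  | |- definable (fun v => forall r : real _ _, @?P v r) =>
      apply: definable_real_all
  | |- definable (fun v => exists r : real _ _, @?P v r) => apply: definable_real_ex
  end.
Ltac def_operation ::= first [def_set_operation | def_field_operation].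

(** * Suprema and infima of definable sets of reals *)

Section Completeness.
Context {M : interp} {hZF : ZF M} {R : ofield M} {hR : real_line R}.
Local Notation K := (real hZF hR).
Local Open Scope ring_scope.
Implicit Types s t : (nat -> M) -> K.

Definition real_sup (Q : K -> Prop) : K :=
  the_real (fun r => (forall x, Q x -> x <= r) /\
    (forall b : K, (forall x, Q x -> x <= b) -> r <= b)).

Definition real_inf (Q : K -> Prop) : K := real_sup (fun r => forall x, Q x -> r <= x).

Lemma def_real_sup (Q : (nat -> M) -> K -> Prop) :
  definable (fun v => Q (fun n => v n.+1) (to_real (v 0%N))) ->
  def_term (fun v => real_val (real_sup (Q v))).
Proof.
move=> dQ; apply: def_the_real.
have dQ' r i : definable (fun v => Q (fun n => v (r n)) (to_real (v i))).
  exact: (definable_rename (fun n => if n is k.+1 then r k else i) dQ).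
by definability; apply: dQ'.
Qed.

Lemma def_real_inf (Q : (nat -> M) -> K -> Prop) :
  definable (fun v => Q (fun n => v n.+1) (to_real (v 0%N))) ->
  def_term (fun v => real_val (real_inf (Q v))).
Proof.
move=> dQ; apply: def_real_sup; definability.
exact: (definable_rename (fun n => if n is k.+1 then k.+2 else 0%N) dQ).
Qed.

(** The completeness axiom speaks of sets of the model only; definability of [Q] provides that
    set. *)
Lemma real_supP (Q : K -> Prop) : definable (fun v => Q (to_real (v 0%N))) ->
  (exists x, Q x) -> (exists b, forall x, Q x -> x <= b) ->
  (forall x, Q x -> x <= real_sup Q) /\
  (forall b, (forall x, Q x -> x <= b) -> real_sup Q <= b).
Proof.
move=> dQ [q Qq] [b Qb].
have [//|S hS] := @separation _ _ (fun x => Q (to_real x)) (car R).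
have ub c : upper_bound R S (real_val c) <-> forall x, Q x -> x <= c.
  split=> [[_ H] x Qx|H].
    by apply/real_leE/H/hS; rewrite real_valK; split=> //; apply: real_valP.
  split=> [|x /hS [xR Qx]]; first exact: real_valP.
  by rewrite -(to_realK xR); apply/real_leE/H.
have [| | |l [lub lleast]] := rl_complete hR (S := S).
- by move=> x /hS [].
- by exists (real_val q); apply/hS; rewrite real_valK; split=> //; apply: real_valP.
- by exists (real_val b); apply/ub.
have lR := lub.1; move: lub lleast; rewrite -(to_realK lR) => /ub lub lleast.
rewrite /real_sup; set S' := fun r => _.
suff : S' (the_real S') by [].
apply: the_realP; exists (to_real l); split.
  by split=> // c /ub /lleast /real_leE.
move=> r [rub rleast]; apply/le_anti; rewrite rleast // andbT.
exact/real_leE/lleast/ub.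
Qed.

Lemma real_infP (Q : K -> Prop) : definable (fun v => Q (to_real (v 0%N))) ->
  (exists x, Q x) -> (exists b, forall x, Q x -> b <= x) ->
  (forall x, Q x -> real_inf Q <= x) /\
  (forall b, (forall x, Q x -> b <= x) -> b <= real_inf Q).
Proof.
move=> dQ [q Qq] [b Qb].
have [| | |H1 H2] := @real_supP (fun r => forall x, Q x -> r <= x).
- by definability.
- by exists b.
- by exists q => x /(_ q Qq).
by split=> [x Qx|c]; [apply: H2 => y; apply | apply: H1].
Qed.

End Completeness.

(** * Negative powers of two *)

Section PowersOfTwo.
Context {M : interp} {hZF : ZF M} {R : ofield M} {hR : real_line R}.
Local Notation K := (real hZF hR).
Local Open Scope ring_scope.

Lemma maps_total (f x : M) (A B : class M) :
  maps f A B -> A x -> exists y, app f x y /\ B y.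
Proof.
move=> [hf tot] /tot [y [hy _]]; exists y; split=> //.
by have /appE /hf /cprodE [? [? [_ [? /pair_inj [_ ->]]]]] := hy.
Qed.

Lemma maps_dom (f x y : M) (A B : class M) : maps f A B -> app f x y -> A x.
Proof.
by move=> [hf _] /appE /hf /cprodE [? [? [? [_ /pair_inj [-> _]]]]].
Qed.

Lemma maps_fun (f x y z : M) (A B : class M) :
  maps f A B -> app f x y -> app f x z -> y = z.
Proof.
move=> fAB xy; have [_ /(_ x (maps_dom fAB xy)) [w [_ uw]]] := fAB.
by move=> xz; rewrite -(uw _ xy) (uw _ xz).
Qed.

Let halving (h : M) := [/\ maps h (@omega M) (elts (car R)), app h emptyset (one R) &
  forall n (x y : K), omega n -> app h n (real_val x) -> app h (succ n) (real_val y) ->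
    y + y = x].

Let is_pow2invE n r : is_pow2inv R n r <-> exists h, halving h /\ app h n r.
Proof.
split=> [[h [hm [h0 [hS hn]]]]|[h [[hm h0 hS] hn]]]; exists h.
  split=> //; split=> //; first by apply/h0/emptysetP.
  move=> m x y om mx my; apply: real_val_inj; apply/esym/real_sumE.
  by apply: hS mx my => //; apply: succP.
split=> //; split; first by move=> e /emptyset_eq ->.
split=> // m s a b om /succ_eq -> ma sb.
have [_ ]:= hm => tot.
have [a' [ha' aR]] := maps_total hm om.
have [b' [hb' bR]] := maps_total hm (omegaS om).
rewrite (maps_fun hm ma ha') (maps_fun hm sb hb') -(to_realK aR) -(to_realK bR).
apply/real_sumE; congr real_val; apply/esym/(hS m) => //; by rewrite to_realK.
Qed.

Let halving_exists : exists h, halving h.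
Proof.
have [|x xR| |h [hm h0 hS]] := @recursion _ _ (car R) (one R)
    (fun x => real_val (to_real x / 2 : K)).
- exact: rl_one.
- exact: real_valP.
- by definability.
exists h; split=> // n x y on nx ny.
have := maps_fun hm ny (hS _ _ on nx); rewrite real_valK => /real_val_inj ->.
lra.
Qed.

(** [is_pow2inv] accepts any witness function, so the power is well defined only because all
    witnesses agree. *)
Let halving_unique h h' : halving h -> halving h' -> forall n, omega n ->
  forall a a', app h n a -> app h' n a' -> a = a'.
Proof.
move=> [hm h0 hS] [hm' h0' hS']; apply: omega_ind; first by definability.
  by move=> a a' ha ha'; rewrite (maps_fun hm ha h0) (maps_fun hm' ha' h0').
move=> n on IH a a' ha ha'.
have tot g : maps g (@omega M) (elts (car R)) -> forall m, omega m ->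
    exists r : K, app g m (real_val r).
  by move=> gm m /(maps_total gm) [y [hy yR]]; exists (to_real y); rewrite to_realK.
have [c hc] := tot h hm n on; have [c' hc'] := tot h' hm' n on.
have /real_val_inj ecc := IH _ _ hc hc'; subst c'.
have [b hb] := tot h hm _ (omegaS on); have [b' hb'] := tot h' hm' _ (omegaS on).
rewrite (maps_fun hm ha hb) (maps_fun hm' ha' hb'); congr real_val.
have := hS _ _ _ on hc hb; have := hS' _ _ _ on hc' hb'; lra.
Qed.

Definition pow2inv (n : M) : K := the_real (fun r => is_pow2inv R n (real_val r)).

Let pow2inv_halving h n : halving h -> omega n -> app h n (real_val (pow2inv n)).
Proof.
move=> hh on; have [hm _ _] := hh.
have [y [hy yR]] := maps_total hm on.
have [|h' [hh' hn']] := (is_pow2invE n (real_val (pow2inv n))).1.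
  apply: (@the_realP _ _ _ _ (fun r => is_pow2inv R n (real_val r))).
  exists (to_real y); split.
    by apply/is_pow2invE; exists h; rewrite to_realK.
  move=> r /is_pow2invE [h' [hh' hn']]; apply: real_val_inj; rewrite to_realK //.
  exact: (halving_unique hh hh' on).
by rewrite -(halving_unique hh hh' on hy hn').
Qed.

Lemma is_pow2invP n r : is_pow2inv R n r <-> omega n /\ r = real_val (pow2inv n).
Proof.
rewrite is_pow2invE; split=> [[h [hh hn]]|[on ->]].
  have [hm _ _] := hh; have on := maps_dom hm hn.
  by split=> //; apply: (maps_fun hm hn); apply: pow2inv_halving.
by have [h hh] := halving_exists; exists h; split=> //; apply: pow2inv_halving.
Qed.

Lemma def_pow2inv (s : (nat -> M) -> M) : def_term s ->
  def_term (fun v => real_val (pow2inv (s v))).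
Proof. by move=> ds; apply: def_the_real; definability. Qed.

Lemma pow2inv0 : pow2inv emptyset = 1.
Proof.
have [h hh] := halving_exists; have [hm h0 _] := hh.
exact/real_val_inj/(maps_fun hm (pow2inv_halving hh (@omega0 M _)) h0).
Qed.

Lemma pow2invS n : omega n -> pow2inv (succ n) + pow2inv (succ n) = pow2inv n.
Proof.
move=> on; have [h hh] := halving_exists; have [hm h0 hS] := hh.
by apply: (hS n) => //; apply: pow2inv_halving => //; apply: omegaS.
Qed.

End PowersOfTwo.

Ltac def_sup_operation :=
  match goal with
  | |- def_term (fun v => real_val (real_sup _)) => apply: def_real_sup
  | |- def_term (fun v => real_val (real_inf _)) => apply: def_real_inf
  | |- def_term (fun v => real_val (pow2inv _)) => apply: def_pow2inv
  end.
Ltac def_operation ::=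
  first [def_set_operation | def_field_operation | def_sup_operation].

(** * The archimedean property and open sets *)

Section Balls.
Context {M : interp} {hZF : ZF M} {R : ofield M} {hR : real_line R}.
Local Notation K := (real hZF hR).
Local Notation pow2inv := (pow2inv : M -> K).
Local Open Scope ring_scope.

Lemma pow2inv_gt0 n : omega n -> 0 < pow2inv n.
Proof.
move: n; apply: omega_ind; first by definability.
  by rewrite pow2inv0 ltr01.
by move=> n on; rewrite -(pow2invS on); lra.
Qed.

Lemma pow2inv_le n : omega n -> forall k, k ∈ n -> pow2inv n <= pow2inv k.
Proof.
move: n; apply: omega_ind; first by definability.
  by move=> k /emptysetP.
move=> n on IH k kn.
have half : pow2inv (succ n) + pow2inv (succ n) = pow2inv n by exact: pow2invS.
have gt0 : 0 < pow2inv (succ n) by exact/pow2inv_gt0/omegaS.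
by case/succP: kn => [/IH|->]; lra.
Qed.

(* The set of lower bounds of the [2^-n] is closed under doubling, so its
   supremum is at most 0. *)
Lemma pow2inv_archi (eps : K) : 0 < eps -> exists n, omega n /\ pow2inv n < eps.
Proof.
move=> eps0; apply: contrapT => none.
pose Q (r : K) := forall n, omega n -> r <= pow2inv n.
have Qeps : Q eps by move=> n on; rewrite leNgt; apply/negP => ?; apply: none; exists n.
have [|||H1 H2] := @real_supP _ _ _ _ Q.
- by rewrite /Q; definability.
- by exists eps.
- by exists 1 => r /(_ emptyset (@omega0 M _)); rewrite pow2inv0.
have : real_sup Q <= real_sup Q / 2; last by have := H1 _ Qeps; lra.
apply: H2 => r Qr; have : Q (r + r).
  move=> n on; rewrite -(pow2invS on).
  have : r <= pow2inv (succ n) by exact/Qr/omegaS.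
  lra.
by move=> /H1; lra.
Qed.

(** By the archimedean property every positive radius exceeds some 2^-n, so arbitrary radii in [K]
    can replace the dyadic ones. Keeping [D] abstract serves a quasi-metric and its conjugate
    alike. *)
Lemma tauP (X : M) (D : M -> M -> M -> Prop) (f : M -> M -> K) V :
  (forall x y z, x ∈ X -> y ∈ X -> D x y z <-> z = real_val (f x y)) ->
  tau R X D V <-> elts V ⊆ elts X /\ forall x, x ∈ V ->
    exists2 eps : K, 0 < eps & forall y, y ∈ X -> f x y < eps -> y ∈ V.
Proof.
move=> Df; split=> -[VX H]; split=> // x xV; have xX := VX _ xV.
  have [n [r [on [/is_pow2invP [_ ->] sub]]]] := H x xV.
  exists (pow2inv n); first exact: pow2inv_gt0.
  move=> y yX fxy; apply: sub; split=> //; exists (real_val (f x y)).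
  by rewrite Df // real_ltE.
have [eps /pow2inv_archi [n [on neps]] sub] := H x xV.
exists n, (real_val (pow2inv n)); split=> //; split; first exact/is_pow2invP.
move=> y [yX [s []]]; rewrite Df // => -> /real_ltE fxy.
by apply: sub => //; apply: lt_trans neps.
Qed.

End Balls.

(** * Quasi-metrics as real-valued functions *)

Section QuasiMetricFunctions.
Context {M : interp} {hZF : ZF M} {R : ofield M} {hR : real_line R}.
Local Notation K := (real hZF hR).
Local Open Scope ring_scope.
Implicit Types (X A V d x y z : M) (f : M -> M -> K).

Definition definable_fun2 f : Prop := forall s t, def_term s -> def_term t ->
  def_term (fun v : nat -> M => real_val (f (s v) (t v))).

End QuasiMetricFunctions.

Ltac def_operation ::=
  first
  [ match goal with
    | H : definable_fun2 ?f |- def_term (fun v => real_val (?f (@?s v) (@?t v))) =>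
        apply: H
    end
  | def_set_operation | def_field_operation | def_sup_operation ].

Section QuasiMetrics.
Context {M : interp} {hZF : ZF M} {R : ofield M} {hR : real_line R}.
Local Notation K := (real hZF hR).
Local Open Scope ring_scope.
Implicit Types (X A V d x y z : M) (f : M -> M -> K).

Record quasimetric_fun X f : Prop := {
  qm_ge0 : forall x y, x ∈ X -> y ∈ X -> 0 <= f x y;
  qm_refl : forall x, x ∈ X -> f x x = 0;
  qm_tri : forall x y z, x ∈ X -> y ∈ X -> z ∈ X -> f x y <= f x z + f z y;
  qm_sep : forall x y, x ∈ X -> y ∈ X -> f x y = 0 -> x = y
}.

(** [f] is total on the model, but its values are constrained on pairs from [X] only. *)
Definition represents X d f : Prop :=
  forall x y z, x ∈ X -> y ∈ X -> (dist d x y z <-> z = real_val (f x y)).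

Definition open_for X f V : Prop :=
  elts V ⊆ elts X /\ forall x, x ∈ V ->
    exists2 eps : K, 0 < eps & forall y, y ∈ X -> f x y < eps -> y ∈ V.

Definition bounded_for X f A : Prop :=
  elts A ⊆ elts X /\ exists x, x ∈ X /\
    exists2 r : K, 0 < r & forall y, y ∈ A -> f x y < r.

Lemma quasi_metric_represented X d : quasi_metric R X d ->
  exists f, [/\ represents X d f, quasimetric_fun X f & definable_fun2 f].
Proof.
move=> [[dm [d0 dtri]] dsep].
exists (fun x y => the_real (fun r => dist d x y (real_val r))).
set f := fun x y => _.
have rep : represents X d f.
  move=> x y z xX yX; have [z0 [h0 u0]] := app2_total dm xX yX.
  have [_ [_ [zR _]]] := app2_dom dm h0.
  suff e : f x y = to_real z0 by rewrite e to_realK //; split=> [/u0|->].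
  apply: the_real_eq; first by rewrite to_realK.
  by move=> r /u0 ->; rewrite real_valK.
split=> //; last first.
  by move=> s t ds dt; apply: def_the_real; definability.
have repf x y : x ∈ X -> y ∈ X -> dist d x y (real_val (f x y)).
  by move=> xX yX; apply/rep.
split.
- move=> x y xX yX; have [_ [_ [_ h]]] := app2_dom dm (repf x y xX yX).
  exact/real_ge0E.
- by move=> x xX; apply: real_val_inj; apply/esym/rep => //; apply: d0.
- move=> x y z xX yX zX; apply/real_leE.
  exact: (dtri x y z _ _ _ _ xX yX zX (repf _ _ xX yX)
    (repf _ _ xX zX) (repf _ _ zX yX) (real_sum _ _)).
- by move=> x y xX yX h; apply: dsep => //; apply/rep => //; rewrite h.
Qed.

Lemma represented_quasi_metric X f : quasimetric_fun X f -> definable_fun2 f ->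
  exists d, quasi_metric R X d /\ represents X d f.
Proof.
move=> fqm df; have [P hP] := product_exists X X.
have [|d [dsub dE]] := @relation_exists _ _ P (car R)
    (fun p z => exists x y, p = pair x y /\ z = real_val (f x y)).
  by definability.
have rep : represents X d f.
  move=> x y z xX yX; split.
    move=> /app2E/appE/dE [_ [_ [x' [y' [/pair_inj [<- <-]]]]]] //.
  move=> ->; apply/app2E/appE/dE; split.
    by apply/hP/cprodE; exists x, y.
  by split; [apply: real_valP | exists x, y].
exists d; split=> //.
have repf x y : x ∈ X -> y ∈ X -> dist d x y (real_val (f x y)).
  by move=> xX yX; apply/rep.
split; last first.
  move=> x y xX yX /rep h; apply: (qm_sep fqm) => //.
  by apply/esym/real_val_inj/h.
split.
  split=> [p|p].
    move=> hp; have /cprodE [q [z [qP [zR pE]]]] := dsub p hp.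
    move: hp; rewrite pE => /appE/dE [_ [_ [x [y [qE zE]]]]]; subst q z.
    apply/cprodE; exists (pair x y), (real_val (f x y)); split; first exact/hP.
    move: qP => /hP /cprodE [x' [y' [xX [yX /pair_inj [ex ey]]]]]; subst x' y'.
    by split=> //; split; [apply: real_valP | apply/real_ge0E/(qm_ge0 fqm)].
  move=> /cprodE [x [y [xX [yX ->]]]]; exists (real_val (f x y)); split.
    by apply/appE/app2E/repf.
  by move=> z /appE /app2E /(rep _ _ _ xX yX).
split=> [x xX|x y z a b c s xX yX zX /(rep _ _ _ xX yX) -> /(rep _ _ _ xX zX) ->].
  by apply/rep => //; rewrite (qm_refl fqm).
move=> /(rep _ _ _ zX yX) -> /real_sumE ->; apply/real_leE; exact: (qm_tri fqm).
Qed.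

Lemma inducesE X d f t1 t2 : represents X d f ->
  induces R X t1 t2 d <->
  (forall V, V ∈ t1 <-> open_for X f V) /\
  (forall V, V ∈ t2 <-> open_for X (fun x y => f y x) V).
Proof.
move=> rep.
have E1 V : tau R X (dist d) V <-> open_for X f V by apply: tauP.
have E2 V : tau R X (conj_dist d) V <-> open_for X (fun x y => f y x) V.
  by apply: tauP => x y z xX yX; apply: rep.
split=> -[H1 H2]; split=> V.
- by rewrite -E1; apply: H1.
- by rewrite -E2; apply: H2.
- by apply: iff_trans (H1 V) _; rewrite E1.
- by apply: iff_trans (H2 V) _; rewrite E2.
Qed.

Lemma d_boundedE X d f A : represents X d f ->
  d_bounded R X d A <-> bounded_for X f A.
Proof.
move=> rep; split=> -[AX [x]].
  move=> [r [xX [rR [r0 sub]]]]; split=> //; exists x; split=> //; exists (to_real r).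
    by apply/real_gt0E; rewrite to_realK.
  move=> y yA; have [_ [s []]] := sub y yA.
  rewrite (rep _ _ _ xX (AX _ yA)) => -> h.
  by apply/real_ltE; rewrite to_realK.
move=> [xX [r r0 sub]]; split=> //; exists x, (real_val r); split=> //.
split; first exact: real_valP.
split; first exact/real_gt0E.
move=> y yA; split; first exact: AX.
exists (real_val (f x y)); split; first by apply/rep => //; apply: AX.
by apply/real_ltE/sub.
Qed.

Lemma separation_open X f (P : M -> Prop) : definable (fun v => P (v 0%N)) ->
  (forall x, x ∈ X -> P x ->
     exists2 eps : K, 0 < eps & forall y, y ∈ X -> f x y < eps -> P y) ->
  exists V, open_for X f V /\ forall x, x ∈ V <-> x ∈ X /\ P x.
Proof.
move=> dP H; have [V hV] := separation X dP.
exists V; split=> //; split=> [x /hV [] //|x /hV [xX Px]].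
by have [eps eps0 h] := H x xX Px; exists eps => // y yX /(h _ yX) ?; apply/hV.
Qed.

(** Neighbourhoods of [x] in the conjugate topology are measured by distances to [x], hence [f a x].
    If no point of [A] is closer than [eps], the complement of the open set of all z with f z x <
    eps is a closed set that contains [A] and misses [x]. *)
Lemma closureP X t f A x : quasimetric_fun X f -> definable_fun2 f ->
  (forall V, V ∈ t <-> open_for X (fun x y => f y x) V) ->
  elts A ⊆ elts X -> x ∈ X ->
  closure X t A x <-> forall eps : K, 0 < eps -> exists2 a, a ∈ A & f a x < eps.
Proof.
move=> fqm df ht AX xX; split.
  move=> [_ cl] eps eps0; apply: contrapT => far.
  have [|z zX zx|U [/ht Ut hU]] :=
    @separation_open X (fun x y => f y x) (fun z => f z x < eps).
  - by definability.
  - exists (eps - f z x) => [|y yX]; first by lra.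
    have := qm_tri fqm yX xX zX; lra.
  have [|Z hZ] := @separation _ _ (fun z => z ∉ U) X; first by definability.
  have /hZ [_ []] : x ∈ Z; last by apply/hU; rewrite (qm_refl fqm).
  apply: cl; last first.
    move=> a aA; apply/hZ; split; first exact: AX.
    by move=> /hU [_ ax]; apply: far; exists a.
  split; first by move=> z /hZ [].
  exists U; split=> // z; split=> [zU|[zX zZ]].
    by split; [case/hU: zU | move=> /hZ []].
  by apply: contrapT => zU; apply: zZ; apply/hZ.
move=> near; split=> // Z [_ [U [/ht [_ Uop] hU]]] AZ; apply: contrapT => xZ.
have [|eps eps0 sub] := Uop x; first by apply/hU.
have [a aA ax] := near eps eps0.
by have [_] := (hU a).1 (sub a (AX _ aA) ax); apply; apply: AZ.
Qed.

End QuasiMetrics.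

(** * Necessity: bounded sets of a quasi-metric *)

Section Forward.
Context {M : interp} {hZF : ZF M} {R : ofield M} {hR : real_line R}.
Local Notation K := (real hZF hR).
Local Open Scope ring_scope.

(** One element may carry many labels; sending it to its least label gives a bijection with a subset
    of [omega] without any choice. *)
Lemma countable_labels (A : M) (I : M -> M -> Prop) :
  definable_rel I ->
  (forall a, a ∈ A -> exists n, omega n /\ I a n) ->
  (forall a a' n, I a n -> I a' n -> a = a') -> countable A.
Proof.
move=> dI label inj; have [w hw] := @omega_set_exists M hZF.
pose least a n := I a n /\ forall k, k ∈ n -> ~ I a k.
have [|S hS] := @separation _ _ (fun n => exists a, a ∈ A /\ least a n) w.
  by rewrite /least; definability.
have [|f [fsub fE]] := @relation_exists _ _ A S least.
  by rewrite /least; definability.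
have leastE a : a ∈ A -> exists! n, app f a n.
  move=> aA.
  have [||n [on [In min]]] := @omega_least _ _ (I a).
  - by definability.
  - exact: label.
  have ln : least a n.
    split=> // k kn Ik; have [ok _] := omega_trans on kn.
    case: (min k ok Ik) => [kE|nk].
      by apply: (mem_irrefl (x := n)); rewrite -{1}kE.
    exact: mem_asym nk kn.
  exists n; split.
    by apply/fE; split=> //; split=> //; apply/hS; rewrite hw; split=> //; exists a.
  move=> m /fE [_ [/hS [/hw om _] [Im lm]]].
  case: (min m om Im) => [//|nm]; by case: (lm n nm).
exists S, f; split; first by move=> n /hS [/hw].
split; first by split.
move=> n nS; have /hS [_ [a [aA la]]] := nS; exists a; split; first exact/fE.
by move=> a' /fE [_ [_ la']]; apply: (inj _ _ n la.1 la'.1).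
Qed.


(** The base consists of the balls of radius 2^n about the fixed point [x0]. Balls with different n
    may coincide, so n serves only as a label. *)
Lemma bounded_countable_base (X B : M) (f : M -> M -> K) (x0 : M) :
  quasimetric_fun X f -> definable_fun2 f -> x0 ∈ X ->
  (forall A, A ∈ B <-> bounded_for X f A) -> has_countable_base B.
Proof.
move=> fqm df x0X hB.
pose w n : K := (pow2inv n)^-1.
pose (ball A n := forall y, y ∈ A <-> y ∈ X /\ f x0 y < w n).
have dball : definable_rel ball by move=> s t ds dt; rewrite /ball /w; definability.
have [|A hA] := @separation _ _ (fun A => exists n, omega n /\ ball A n) B.
  by definability.
exists A; split; last first.
  apply: (@countable_labels _ ball) => [//|a /hA [_] //|a a' n ha ha'].
  by apply: (zf_extensionality hZF) => y; rewrite (ha y) (ha' y).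
split=> [a /hA [] //|C /hB [CX [x [xX [r r0 sub]]]]].
(* By the triangle inequality, a set within [r] of [x] lies within [f x0 x + r] of [x0]. *)
have [n [on wn]] : exists n, omega n /\ f x0 x + r < w n.
  have s0 : 0 < f x0 x + r by have := qm_ge0 fqm x0X xX; lra.
  have [|n [on hn]] := @pow2inv_archi _ _ _ hR (f x0 x + r)^-1.
    by rewrite invr_gt0.
  exists n; split=> //; rewrite -[ltLHS]invrK ltf_pV2 ?posrE ?invr_gt0 //.
  exact: pow2inv_gt0.
have [|D hD] := @separation _ _ (fun y => f x0 y < w n) X.
  by rewrite /w; definability.
exists D; split; last first.
  move=> y yC; apply/hD; split; first exact: CX.
  have := qm_tri fqm x0X (CX _ yC) xX; have := sub y yC; lra.
apply/hA; split; last by exists n.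
apply/hB; split; first by move=> y /hD [].
exists x0; split=> //; exists (w n); last by move=> y /hD [].
by rewrite invr_gt0 pow2inv_gt0.
Qed.

(** Enlarging the radius by 1 suffices: a point y of the second closure has some a in [A] with f a y
    < 1, and balls of [f] are open in the first topology. *)
Lemma bounded_proper (X B t1 t2 : M) (f : M -> M -> K) :
  quasimetric_fun X f -> definable_fun2 f ->
  (forall V, V ∈ t1 <-> open_for X f V) ->
  (forall V, V ∈ t2 <-> open_for X (fun x y => f y x) V) ->
  (forall A, A ∈ B <-> bounded_for X f A) -> proper X t1 t2 B.
Proof.
move=> fqm df ht1 ht2 hB A /hB [AX [x [xX [r r0 sub]]]].
have [||C [/ht1 Ct hC]] := @separation_open _ _ _ hR X f (fun y => f x y < r + 1).
- by definability.
- move=> y yX yr; exists (r + 1 - f x y) => [|z zX]; first by lra.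
  have := qm_tri fqm xX zX yX; lra.
exists C; split.
  apply/hB; split; first by move=> y /hC [].
  exists x; split=> //; exists (r + 1); first by lra.
  by move=> y /hC [].
move=> y cly; have yX := cly.1; exists C; split=> //; split=> //.
apply/hC; split=> //.
have [|a aA ay] := (closureP fqm df ht2 AX yX).1 cly 1; first by lra.
have := qm_tri fqm xX yX (AX _ aA); have := sub a aA; lra.
Qed.

End Forward.

(** * Exhaustion functions *)

(** The ratios differ by (a'b - ab') / ((a + b)(a' + b')). Bounding b by b' + d and then a' by a + d
    shows a'b - ab' ≤ d(a' + b'); the opposite order gives d(a + b). Either factor of the
    denominator can thus be cancelled. *)
Lemma ratio_shift (F : realFieldType) (a b a' b' d : F) :
  (0 <= a -> 0 <= b -> 0 <= a' -> 0 <= b' -> 0 <= d -> 0 < a + b -> 0 < a' + b' ->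
   a' <= a + d -> b <= b' + d ->
   a' / (a' + b') <= a / (a + b) + d / (a + b) /\
   a' / (a' + b') <= a / (a + b) + d / (a' + b'))%R.
Proof.
move=> a0 b0 a'0 b'0 d0 s0 s'0 ha hb.
have h1 : (a' * b <= a' * (b' + d))%R by apply: ler_wpM2l.
have h2 : (a' * b' <= (a + d) * b')%R by apply: ler_wpM2r.
have h3 : (a' * b <= (a + d) * b)%R by apply: ler_wpM2r.
have h4 : (a * b <= a * (b' + d))%R by apply: ler_wpM2l.
split.
  rewrite -mulrDl ler_pdivrMr // mulrAC ler_pdivlMr //.
  by move: h1 h2; rewrite !mulrDl !mulrDr; lra.
rewrite -lerBlDr -mulrBl ler_pdivrMr // mulrAC ler_pdivlMr //.
by move: h3 h4; rewrite !mulrDl !mulrDr !mulNr; lra.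
Qed.

Section Exhaustion.
Context {M : interp} {hZF : ZF M} {R : ofield M} {hR : real_line R}.
Local Notation K := (real hZF hR).
Local Open Scope ring_scope.

Variables (X : M) (e : M -> M -> K).
Hypotheses (eqm : quasimetric_fun X e) (de : definable_fun2 e).

(* The value 1 keeps the infimum meaningful when [C] is empty. *)
Definition gap (e' : M -> M -> K) (C : M -> Prop) (x : M) : K :=
  real_inf (fun r => r = 1 \/ exists c, c ∈ X /\ C c /\ r = e' c x).

Lemma gapP (e' : M -> M -> K) (C : M -> Prop) x : definable_fun2 e' ->
  definable (fun v => C (v 0%N)) ->
  (forall c, c ∈ X -> x ∈ X -> 0 <= e' c x) -> x ∈ X ->
  [/\ 0 <= gap e' C x, gap e' C x <= 1,
      forall c, c ∈ X -> C c -> gap e' C x <= e' c x &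
      forall b : K, b <= 1 -> (forall c, c ∈ X -> C c -> b <= e' c x) ->
        b <= gap e' C x].
Proof.
move=> de' dC ge0 xX.
have [||| H1 H2] := @real_infP _ _ _ hR
  (fun r => r = 1 \/ exists c, c ∈ X /\ C c /\ r = e' c x).
- by definability.
- by exists 1; left.
- by exists 0 => r [->|[c [cX [_ ->]]]]; [apply: ler01 | apply: ge0].
split.
- by apply: H2 => r [->|[c [cX [_ ->]]]]; [apply: ler01 | apply: ge0].
- by apply: H1; left.
- by move=> c cX Cc; apply: H1; right; exists c.
- by move=> b b1 hb; apply: H2 => r [->|[c [cX [Cc ->]]]] //; apply: hb.
Qed.

Let gap_shift (e' : M -> M -> K) (C : M -> Prop) x y : definable_fun2 e' ->
  definable (fun v => C (v 0%N)) ->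
  (forall c x, c ∈ X -> x ∈ X -> 0 <= e' c x) ->
  (forall c x y, c ∈ X -> x ∈ X -> y ∈ X -> e' c y <= e' c x + e' x y) ->
  x ∈ X -> y ∈ X -> gap e' C y <= gap e' C x + e' x y.
Proof.
move=> de' dC ge0 tri xX yX.
have [_ y1 yC _] := gapP de' dC (fun c cX _ => ge0 c y cX yX) yX.
have [_ _ _ xC] := gapP de' dC (fun c cX _ => ge0 c x cX xX) xX.
(* The default value 1 survives the shift because the gap at [y] is at most 1 and [e'] is
   nonnegative. *)
rewrite -lerBlDr; apply: xC; first by have := ge0 x y xX yX; lra.
by move=> c cX Cc; have := yC c cX Cc; have := tri c x y cX xX yX; lra.
Qed.

Variables C D : M -> M -> Prop.
Hypotheses (dC : definable_rel C) (dD : definable_rel D).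

Definition below n x : K := gap e (C n) x.
(** The distance from [x] to the complement of D_n, written as a gap for the conjugate so that
    [gap_shift] applies to it as well. *)
Definition above n x : K := gap (fun x y => e y x) (fun z => ~ D n z) x.

Hypothesis C_mono : forall n k, omega n -> k ∈ n -> forall x, C k x -> C n x.
Hypothesis separated : forall n x, omega n -> x ∈ X -> 0 < below n x + above n x.
(** Every point has a neighbourhood in the first topology on which all u_n vanish from some index
    on. *)
Hypothesis C_cover : forall x, x ∈ X -> exists n, omega n /\
  exists2 eps : K, 0 < eps & forall y, y ∈ X -> e x y < eps -> C n y.

Let dCn n : definable (fun v => C n (v 0%N)).
Proof. by definability. Qed.

Let dDn n : definable (fun v => ~ D n (v 0%N)).
Proof. by definability. Qed.

Let de' : definable_fun2 (fun x y => e y x).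
Proof. by move=> s t ds dt; apply: de. Qed.

Let e0 c x : c ∈ X -> x ∈ X -> 0 <= e c x.
Proof. by move=> cX xX; apply: (qm_ge0 eqm). Qed.

Let e0' c x : c ∈ X -> x ∈ X -> 0 <= e x c.
Proof. by move=> cX xX; apply: (qm_ge0 eqm). Qed.

Let belowP n x (xX : x ∈ X) := @gapP e (C n) x de (dCn n) (fun c cX _ => e0 cX xX) xX.
Let aboveP n x (xX : x ∈ X) := @gapP (fun x y => e y x) (fun z => ~ D n z) x
  de' (dDn n) (fun c cX _ => e0' cX xX) xX.

Let below_shift n x y : x ∈ X -> y ∈ X -> below n y <= below n x + e x y.
Proof.
apply: (gap_shift de (dCn n) e0) => c {}x {}y cX xX yX; exact: (qm_tri eqm).
Qed.

Let above_shift n x y : x ∈ X -> y ∈ X -> above n y <= above n x + e y x.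
Proof.
apply: (gap_shift de' (dDn n) e0') => c {}x {}y cX xX yX.
by rewrite addrC; apply: (qm_tri eqm).
Qed.

Definition weight n : K := (pow2inv n)^-1.

Lemma weight_gt0 n : omega n -> 0 < weight n.
Proof. by move=> on; rewrite invr_gt0 pow2inv_gt0. Qed.

Definition urysohn n x : K := below n x / (below n x + above n x).

Let urysohn_le1 n x : omega n -> x ∈ X -> urysohn n x <= 1.
Proof.
move=> on xX; have s0 := separated on xX; have [a0 _ _ _] := aboveP n xX.
by rewrite ler_pdivrMr // mul1r lerDl.
Qed.

Let urysohn_C n x : x ∈ X -> C n x -> urysohn n x = 0.
Proof.
move=> xX Cx; have [b0 _ bC _] := belowP n xX.
suff -> : urysohn n x = 0 / (below n x + above n x) by rewrite mul0r.
congr (_ / _); apply/le_anti; rewrite b0 andbT.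
by rewrite -(qm_refl eqm xX); apply: bC.
Qed.

Let urysohn_notD n x : omega n -> x ∈ X -> ~ D n x -> urysohn n x = 1.
Proof.
move=> on xX Dx; have s0 := separated on xX; have [a0 _ aD _] := aboveP n xX.
have a_eq0 : above n x = 0.
  by apply/le_anti; rewrite a0 andbT -(qm_refl eqm xX); apply: aD.
by rewrite /urysohn; move: s0; rewrite a_eq0 addr0 => s0; rewrite divff // gt_eqF.
Qed.

Let urysohn_shift n x y : omega n -> x ∈ X -> y ∈ X ->
  urysohn n y <= urysohn n x + e x y / (below n x + above n x) /\
  urysohn n y <= urysohn n x + e x y / (below n y + above n y).
Proof.
move=> on xX yX; have [bx _ _ _] := belowP n xX; have [by_ _ _ _] := belowP n yX.
have [ax _ _ _] := aboveP n xX; have [ay _ _ _] := aboveP n yX.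
apply: ratio_shift => //; [exact: e0 | exact: separated | exact: separated | |].
  exact: below_shift.
exact: above_shift.
Qed.

Definition exhaustion x : K :=
  real_sup (fun r => r = 0 \/ exists n, omega n /\ r = weight n * urysohn n x).

Lemma def_exhaustion s : def_term s ->
  def_term (fun v : nat -> M => real_val (exhaustion (s v))).
Proof.
by move=> ds; rewrite /exhaustion /weight /urysohn /below /above /gap; definability.
Qed.

(** On C_m the terms from index [m] on vanish, and an earlier term is at most its own weight, which
    does not exceed that of [m]. *)
Let weighted_le n m x : omega n -> omega m -> x ∈ X -> C m x ->
  weight n * urysohn n x <= weight m.
Proof.
move=> on om xX Cx; have wm := weight_gt0 om.
have Cnx k : omega k -> k = m \/ m ∈ k -> weight k * urysohn k x <= weight m.
  move=> ok mk; rewrite urysohn_C ?mulr0 ?ltW //.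
  by case: mk => [->|mk] //; apply: (C_mono ok mk).
have [nm|nm] := omega_total om on; last exact: Cnx.
have wn := weight_gt0 on.
apply: (@le_trans _ _ (weight n)).
  by rewrite ger_pMr // urysohn_le1.
by rewrite lef_pV2 ?posrE ?pow2inv_gt0 // pow2inv_le.
Qed.

Let exhaustionP x : x ∈ X ->
  [/\ 0 <= exhaustion x,
      forall n, omega n -> weight n * urysohn n x <= exhaustion x &
      forall b : K, 0 <= b -> (forall n, omega n -> weight n * urysohn n x <= b) ->
        exhaustion x <= b].
Proof.
move=> xX; have [m [om [eps eps0 hm]]] := C_cover xX.
have Cx : C m x by apply: hm => //; rewrite (qm_refl eqm).
have [||| H1 H2] := @real_supP _ _ _ hR
  (fun r => r = 0 \/ exists n, omega n /\ r = weight n * urysohn n x).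
- by rewrite /weight /urysohn /below /above /gap; definability.
- by exists 0; left.
- exists (weight m) => r [->|[n [on ->]]]; first exact/ltW/weight_gt0.
  exact: weighted_le.
split; first by apply: H1; left.
  by move=> n on; apply: H1; right; exists n.
by move=> b b0 hb; apply: H2 => r [->|[n [on ->]]] //; apply: hb.
Qed.

Lemma exhaustion_ge0 x : x ∈ X -> 0 <= exhaustion x.
Proof. by move=> /exhaustionP []. Qed.

Lemma exhaustion_le m x : omega m -> x ∈ X -> C m x -> exhaustion x <= weight m.
Proof.
move=> om xX Cx; have [_ _ least] := exhaustionP xX.
apply: least; first exact/ltW/weight_gt0.
by move=> n on; apply: weighted_le.
Qed.

(** Take n with 2^n > b: a point off D_n has u_n = 1, which forces the supremum there to be at least
    2^n. *)
Lemma exhaustion_bounded (A : M) (b : K) : elts A ⊆ elts X ->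
  (forall x, x ∈ A -> exhaustion x <= b) ->
  exists n, omega n /\ forall x, x ∈ A -> D n x.
Proof.
move=> AX hb.
have [n [on wn]] : exists n, omega n /\ b < weight n.
  (* The inverse of [b] is a usable radius only for positive [b]; otherwise 2^0 already exceeds
     it. *)
  have [b0|b0] := leP b 0.
    exists emptyset; split; first exact: omega0.
    exact: le_lt_trans b0 (weight_gt0 (@omega0 M _)).
  have [|n [on hn]] := @pow2inv_archi _ _ _ hR b^-1; first by rewrite invr_gt0.
  exists n; split=> //; rewrite -[ltLHS]invrK ltf_pV2 ?posrE ?invr_gt0 //.
  exact: pow2inv_gt0.
exists n; split=> // x xA; apply: contrapT => Dx; have xX := AX x xA.
have [_ ub _] := exhaustionP xX.
have := ub n on; rewrite urysohn_notD // mulr1; have := hb x xA; lra.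
Qed.

(** A minimum over all n below [m], taken by induction inside the model because [m] may be
    nonstandard. The conjunctive restatement is a form that the definability tactic understands. *)
Let uniform_shift x (eps : K) m : x ∈ X -> 0 < eps -> omega m ->
  exists2 del : K, 0 < del & forall n, n ∈ m ->
    weight n * del <= eps * (below n x + above n x).
Proof.
move=> xX eps0; move: m.
suff : forall m, omega m -> exists del : K, 0 < del /\ forall n, n ∈ m ->
    weight n * del <= eps * (below n x + above n x).
  by move=> H m /H [del [? ?]]; exists del.
apply: omega_ind.
- by rewrite /weight /below /above /gap; definability.
- by exists 1; split=> [|n /emptysetP //]; apply: ltr01.
- move=> m om [del [del0 IH]].
  have s0 := separated om xX; have w0 := weight_gt0 om.
  exists (Num.min del (eps * (below m x + above m x) / weight m)); split.
    by rewrite lt_min del0 divr_gt0 // mulr_gt0.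
  move=> n /succP [nm|->]; last first.
    rewrite mulrC -ler_pdivlMr // ge_min lexx orbT //.
  apply: le_trans (IH n nm); rewrite ler_pM2l ?ge_min ?lexx //.
  by apply: weight_gt0; have [] := omega_trans om nm.
Qed.

(* [exhaustion] is upper semicontinuous for the first topology since, near [x],
   only finitely many terms of the supremum differ from 0. *)
Lemma exhaustion_usc x (eps : K) : x ∈ X -> 0 < eps ->
  exists2 del : K, 0 < del & forall y, y ∈ X -> e x y < del ->
    exhaustion y <= exhaustion x + eps.
Proof.
move=> xX eps0; have [m [om [del1 del10 near]]] := C_cover xX.
have [del2 del20 hdel2] := uniform_shift xX eps0 om.
exists (Num.min del1 del2); first by rewrite lt_min del10.
move=> y yX; rewrite lt_min => /andP [/(near _ yX) Cy exy].
have [x0 ub _] := exhaustionP xX; have [_ _ least] := exhaustionP yX.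
apply: least => [|n on]; first by apply: addr_ge0 => //; apply: ltW.
have wn := weight_gt0 on; have s0 := separated on xX.
have [nm|mn] := omega_total om on; last first.
  rewrite urysohn_C ?mulr0 //; first by apply: addr_ge0 => //; apply: ltW.
  by case: mn => [->|mn] //; apply: (C_mono on mn).
have [sh _] := urysohn_shift on xX yX.
apply: (@le_trans _ _ (weight n * (urysohn n x + e x y / (below n x + above n x)))).
  by rewrite ler_pM2l.
rewrite mulrDr; apply: lerD; first exact: ub.
rewrite mulrA ler_pdivrMr //.
by apply: le_trans (hdel2 n nm); rewrite ler_pM2l // ltW.
Qed.

(** Only [x] has to lie in C_m, since it is the terms at [x] that are estimated. The moving point is
    now the first argument of [e], so the second bound of [urysohn_shift] is the one that keeps the
    denominator at [x]. *)
Lemma exhaustion_lsc x (eps : K) : x ∈ X -> 0 < eps ->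
  exists2 del : K, 0 < del & forall y, y ∈ X -> e y x < del ->
    exhaustion x <= exhaustion y + eps.
Proof.
move=> xX eps0; have [m [om [del1 del10 near]]] := C_cover xX.
have Cx : C m x by apply: near => //; rewrite (qm_refl eqm).
have [del del0 hdel] := uniform_shift xX eps0 om.
exists del => // y yX eyx.
have [y0 ub _] := exhaustionP yX; have [_ _ least] := exhaustionP xX.
apply: least => [|n on]; first by apply: addr_ge0 => //; apply: ltW.
have wn := weight_gt0 on; have s0 := separated on xX.
have [nm|mn] := omega_total om on; last first.
  rewrite urysohn_C ?mulr0 //; first by apply: addr_ge0 => //; apply: ltW.
  by case: mn => [->|mn] //; apply: (C_mono on mn).
have [_ sh] := urysohn_shift on yX xX.
apply: (@le_trans _ _ (weight n * (urysohn n y + e y x / (below n x + above n x)))).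
  by rewrite ler_pM2l.
rewrite mulrDr; apply: lerD; first exact: ub.
rewrite mulrA ler_pdivrMr //.
by apply: le_trans (hdel n nm); rewrite ler_pM2l // ltW.
Qed.

End Exhaustion.

(** * Sufficiency: construction of the new quasi-metric *)

Section Backward.
Context {M : interp} {hZF : ZF M} {R : ofield M} {hR : real_line R}.
Local Notation K := (real hZF hR).
Local Open Scope ring_scope.

Definition truncate (f : M -> M -> K) (x y : M) : K := if f x y <= 1 then f x y else 1.

Lemma truncate_quasimetric X f : quasimetric_fun X f -> quasimetric_fun X (truncate f).
Proof.
move=> fqm; split.
- by move=> x y xX yX; rewrite /truncate; case: ifP => // _; apply: (qm_ge0 fqm).
- by move=> x xX; rewrite /truncate (qm_refl fqm) // ler01.
- move=> x y z xX yX zX; have := qm_tri fqm xX yX zX.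
  have := qm_ge0 fqm xX zX; have := qm_ge0 fqm zX yX.
  rewrite /truncate; case: (leP (f x y) 1) => ?; case: (leP (f x z) 1) => ?;
    case: (leP (f z y) 1) => ?; lra.
- move=> x y xX yX; rewrite /truncate; case: ifP => _; first exact: (qm_sep fqm).
  by move=> /eqP; rewrite oner_eq0.
Qed.

Lemma def_truncate f : definable_fun2 f -> definable_fun2 (truncate f).
Proof. by move=> df s t ds dt; rewrite /truncate; definability. Qed.

Lemma truncate_le1 f x y : truncate f x y <= 1.
Proof. by rewrite /truncate; case: ifP. Qed.

Lemma truncate_le f x y : truncate f x y <= f x y.
Proof. by rewrite /truncate; case: (leP (f x y) 1) => // /ltW. Qed.

(** Below 1 the truncation is invisible; this is the origin of the radii [Num.min eps 1] used
    later. *)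
Lemma truncate_lt f x y (eps : K) : truncate f x y < Num.min eps 1 -> f x y < eps.
Proof.
by rewrite /truncate; case: ifP => _; rewrite lt_min ?ltxx ?andbF // => /andP [].
Qed.

Lemma open_for_finer (X : M) (f g : M -> M -> K) V :
  (forall x (eps : K), x ∈ X -> 0 < eps -> exists2 del : K, 0 < del &
     forall y, y ∈ X -> g x y < del -> f x y < eps) ->
  open_for X f V -> open_for X g V.
Proof.
move=> fg [VX Vf]; split=> // x xV; have [eps eps0 sub] := Vf x xV.
have [del del0 h] := fg x eps (VX x xV) eps0.
by exists del => // y yX /(h y yX); apply: sub.
Qed.

Variables (X B t1 t2 : M) (f : M -> M -> K).
Hypotheses (fqm : quasimetric_fun X f) (df : definable_fun2 f)
  (ht1 : forall V, V ∈ t1 <-> open_for X f V)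
  (ht2 : forall V, V ∈ t2 <-> open_for X (fun x y => f y x) V)
  (hB : bornology X B) (hprop : proper X t1 t2 B) (X_inh : exists x, x ∈ X).

Section Base.
Variables (A S h : M).
Hypotheses (hA : base_of B A) (hS : elts S ⊆ @omega M)
  (hh : bijection h (elts A) (elts S)).

(** The set C_n, formed from the base members with label below [n]. Not every natural number needs
    to be a label. *)
Definition layer n x : Prop := exists a k, a ∈ A /\ app h a k /\ k ∈ n /\ x ∈ a.

(* The [t2]-closure of [layer n] lies in the [t1]-interior of [layer m]. *)
Definition separates n m : Prop := forall x, x ∈ X ->
  (forall eps : K, 0 < eps -> exists a, a ∈ X /\ layer n a /\ f a x < eps) ->
  exists eps : K, 0 < eps /\ forall y, y ∈ X -> f x y < eps -> layer m y.

(* The layers increase, so this intersection is the layer of the least such [m]. *)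
Definition next_layer n x : Prop := forall m, omega m -> separates n m -> layer m x.

Lemma definable_layer : definable_rel layer.
Proof. by move=> s t ds dt; rewrite /layer; definability. Qed.

Lemma definable_separates : definable_rel separates.
Proof. by move=> s t ds dt; rewrite /separates /layer; definability. Qed.

Lemma definable_next_layer : definable_rel next_layer.
Proof. by move=> s t ds dt; rewrite /next_layer /separates /layer; definability. Qed.

Lemma bornology_sub E : E ∈ B -> elts E ⊆ elts X.
Proof. by have [[_ [BX _]] _] := hB; apply: BX. Qed.

Lemma layer_sub n x : layer n x -> x ∈ X.
Proof. by move=> [a [k [/(hA.1) /bornology_sub aX [_ [_ /aX]]]]]. Qed.

(** Labels are injective, so each step of the induction adds at most one base member and closure
    under binary unions suffices. *)
Lemma layer_bounded n : omega n -> exists c, c ∈ B /\ forall x, x ∈ c <-> layer n x.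
Proof.
have [[[E EB] [BX [Bsub Bun]]] _] := hB.
move: n; apply: omega_ind; first by have dl := definable_layer; definability.
  have [|c hc] := @separation _ _ (fun x => ~ x = x) E; first by definability.
  exists c; split; first by apply: Bsub EB _ => x /hc [].
  by move=> x; split=> [/hc []|[a [k [_ [_ [/emptysetP]]]]]].
move=> n on [c [cB hc]].
have layerS x :
    layer (succ n) x <-> layer n x \/ exists a, a ∈ A /\ app h a n /\ x ∈ a.
  split=> [[a [k [aA [ak [/succP [kn|kn] xa]]]]]|
    [[a [k [aA [ak [kn xa]]]]]|[a [aA [an xa]]]]].
  - by left; exists a, k.
  - by right; exists a; rewrite -kn.
  - by exists a, k; do 3 split=> //; apply/succP; left.
  - by exists a, n; do 3 split=> //; apply/succP; right.
(* When [n] is not a label, the layer does not grow. *)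
have [[a [aA an]]|none] := pselect (exists a, a ∈ A /\ app h a n).
  have [|u hu] := @separation _ _ (fun x => x ∈ c \/ x ∈ a) X.
    by definability.
  exists u; split; last first.
    move=> x; rewrite hu layerS hc; split=> [[_ [|xa]]|[lx|[a' [a'A [a'n xa']]]]].
    - by left.
    - by right; exists a.
    - by split; [apply: layer_sub lx | left].
    - split; first by apply: (bornology_sub (hA.1 _ a'A)).
      have [hm hinj] := hh.
      have [k [ak kS]] := maps_total hm aA; rewrite (maps_fun hm ak an) in kS.
      have [a0 [_ u0]] := hinj n kS.
      by right; rewrite -(u0 a an) (u0 a' a'n).
  apply: (Bun c a) => //; first exact: hA.1.
  move=> x; rewrite hu; split=> [[]|] // H; split=> //.
  by case: H => [/(bornology_sub cB)|/(bornology_sub (hA.1 _ aA))].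
exists c; split=> // x; rewrite hc layerS; split=> [|[|[a [aA [an _]]]]] //.
  by left.
by case: none; exists a.
Qed.

Lemma layer_mono n k : omega n -> k ∈ n -> forall x, layer k x -> layer n x.
Proof.
move=> on kn x [a [j [aA [aj [jk xa]]]]]; exists a, j; do 3 split=> //.
by have [_ sub] := omega_trans on kn; apply: sub.
Qed.

Lemma layer_cofinal E : E ∈ B -> exists n, omega n /\ forall x, x ∈ E -> layer n x.
Proof.
move=> /hA.2 [a [aA Ea]]; have [k [ak kS]] := maps_total hh.1 aA.
(* A layer uses labels strictly below its index, hence the successor. *)
have ok := hS kS; exists (succ k); split; first exact: omegaS.
by move=> x /Ea xa; exists a, k; do 3 split=> //; apply/succP; right.
Qed.

Lemma separates_exists n : omega n -> exists m, omega m /\ separates n m.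
Proof.
move=> /layer_bounded [c [cB hc]]; have [E [EB cE]] := hprop cB.
have [m [om Em]] := layer_cofinal EB; exists m; split=> // x xX near.
have [|U [/ht1 [UX Uop] [UE xU]]] := cE x.
  apply/(closureP fqm df ht2 (bornology_sub cB) xX) => eps /near [a [_ [la ax]]].
  by exists a => //; apply/hc.
have [eps eps0 sub] := Uop x xU; exists eps; split=> // y yX /(sub y yX) yU.
exact/Em/UE.
Qed.

Lemma next_layerE n : omega n -> exists m,
  [/\ omega m, separates n m & forall x, next_layer n x <-> layer m x].
Proof.
move=> on; have dsep := definable_separates.
have [||m [om [sm least]]] := @omega_least _ _ (separates n).
- by definability.
- exact: separates_exists.
exists m; split=> // x; split=> [|lx m' om' /(least _ om') [->|mm']] //; first exact.
exact: layer_mono mm' _ lx.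
Qed.

(** If the first summand vanishes, [x] is in the second closure of the layer, so a ball about [x]
    lies in the next layer and its radius, cut at 1, bounds the other summand from below. *)
Lemma layers_separated n x : omega n -> x ∈ X ->
  0 < below X (truncate f) layer n x + above X (truncate f) next_layer n x.
Proof.
move=> on xX; have eqm := truncate_quasimetric fqm.
have de := def_truncate df.
have de' : definable_fun2 (fun x y => truncate f y x) by move=> s t ds dt; apply: de.
have dl := definable_layer; have dnl := definable_next_layer.
have e0 c : c ∈ X -> x ∈ X -> 0 <= truncate f c x.
  by move=> cX _; apply: (qm_ge0 eqm).
have e0' c : c ∈ X -> x ∈ X -> 0 <= truncate f x c.
  by move=> cX _; apply: (qm_ge0 eqm).
have [|b0 b1 _ bglb] := @gapP _ _ _ _ X (truncate f) (layer n) x de _ e0 xX.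
  by definability.
have [|a0 a1 _ aglb] := @gapP _ _ _ _ X _ (fun z => ~ next_layer n z) x de' _ e0' xX.
  by definability.
have [b_gt0|b_le0] := ltP 0 (below X (truncate f) layer n x).
  by apply: ltr_wpDr.
apply: ltr_wpDl => //.
have [m [om sm nlE]] := next_layerE on.
have [eps eps0|eps [eps0 sub]] := sm x xX.
  apply: contrapT => none.
  have : Num.min eps 1 <= below X (truncate f) layer n x.
    apply: bglb => [|c cX lc]; first by rewrite ge_min lexx orbT.
    by rewrite leNgt; apply/negP => /truncate_lt cx; apply: none; exists c.
  by apply/negP; rewrite -ltNge; apply: le_lt_trans b_le0 _; rewrite lt_min eps0 ltr01.
apply: (@lt_le_trans _ _ (Num.min eps 1)); first by rewrite lt_min eps0 ltr01.
apply: aglb => [|c cX lc]; first by rewrite ge_min lexx orbT.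
by rewrite leNgt; apply/negP => /truncate_lt /(sub c cX) /nlE.
Qed.

(** The singleton of [x] belongs to the bornology, so some layer contains [x]; a layer separated
    from it then contains a ball about [x]. *)
Lemma layers_cover x : x ∈ X -> exists n, omega n /\
  exists2 eps : K, 0 < eps & forall y, y ∈ X -> truncate f x y < eps -> layer n y.
Proof.
move=> xX; have [sx hsx] := upair_exists x x.
have [n [on xn]] := layer_cofinal (hB.2 x sx xX hsx).
have [m [om sm]] := separates_exists on.
have [eps eps0|eps [eps0 sub]] := sm x xX.
  exists x; split=> //; split; first by apply: xn; apply/hsx; left.
  by rewrite (qm_refl fqm).
exists m; split=> //; exists (Num.min eps 1); first by rewrite lt_min eps0 ltr01.
by move=> y yX /truncate_lt; apply: sub.
Qed.

Lemma layers_exhaustion : exists F : M -> K,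
  [/\ forall s, def_term s -> def_term (fun v : nat -> M => real_val (F (s v))),
      forall x, x ∈ X -> 0 <= F x,
      forall E, E ∈ B <-> elts E ⊆ elts X /\
        exists b, forall x, x ∈ E -> F x <= b,
      forall x (eps : K), x ∈ X -> 0 < eps -> exists2 del : K, 0 < del &
        forall y, y ∈ X -> truncate f x y < del -> F y <= F x + eps &
      forall x (eps : K), x ∈ X -> 0 < eps -> exists2 del : K, 0 < del &
        forall y, y ∈ X -> truncate f y x < del -> F x <= F y + eps].
Proof.
have eqm := truncate_quasimetric fqm; have de := def_truncate df.
have dl := definable_layer; have dnl := definable_next_layer.
exists (exhaustion X (truncate f) layer next_layer); split.
- exact: def_exhaustion.
- exact: (exhaustion_ge0 eqm de dl dnl layer_mono layers_separated layers_cover).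
- move=> E; split=> [EB|[EX [b Eb]]].
    split; first exact: bornology_sub.
    have [n [on En]] := layer_cofinal EB; exists (weight n) => x xE.
    apply: (exhaustion_le eqm de dl dnl layer_mono layers_separated layers_cover) => //.
      exact: bornology_sub EB _ xE.
    exact: En.
  have [n [on En]] :=
    exhaustion_bounded eqm de dl dnl layer_mono layers_separated layers_cover EX Eb.
  (* The set D_n is itself a layer, hence a member of the bornology; this turns a bound on the
     function into boundedness. *)
  have [m [om _ nlE]] := next_layerE on; have [c [cB hc]] := layer_bounded om.
  have [[_ [_ [Bsub _]]] _] := hB.
  by apply: Bsub cB _ => y yE; apply/hc/nlE/En.
- exact: (exhaustion_usc eqm de dl dnl layer_mono layers_separated layers_cover).
- exact: (exhaustion_lsc eqm de dl dnl layer_mono layers_separated layers_cover).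
Qed.

End Base.

Definition max_increment (e : M -> M -> K) (F : M -> K) (x y : M) : K :=
  if e x y <= F y - F x then F y - F x else e x y.

Lemma max_increment_ge e F x y :
  e x y <= max_increment e F x y /\ F y - F x <= max_increment e F x y.
Proof. by rewrite /max_increment; case: ifP => [|/negbT]; rewrite -?ltNge; lra. Qed.

Lemma max_increment_lt e F x y (r : K) :
  max_increment e F x y < r <-> e x y < r /\ F y - F x < r.
Proof.
split=> [gr|[er Fr]]; last by rewrite /max_increment; case: ifP.
by have [? ?] := max_increment_ge e F x y; split; apply: le_lt_trans gr.
Qed.

(** The increment of [F] is additive along [x], [z], [y], so the maximum keeps the triangle
    inequality; it dominates [e], which gives nonnegativity and separation of points. *)
Lemma max_increment_quasimetric e F :
  quasimetric_fun X e -> quasimetric_fun X (max_increment e F).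
Proof.
move=> eqm; split.
- move=> x y xX yX; apply: le_trans (max_increment_ge e F x y).1.
  exact: (qm_ge0 eqm).
- by move=> x xX; rewrite /max_increment subrr (qm_refl eqm) // lexx.
- move=> x y z xX yX zX.
  have [g1 g2] := max_increment_ge e F x z; have [g3 g4] := max_increment_ge e F z y.
  have := qm_tri eqm xX yX zX; rewrite {1}/max_increment; case: ifP => _; lra.
- move=> x y xX yX gxy; apply: (qm_sep eqm) => //; apply/le_anti.
  by rewrite (qm_ge0 eqm) // andbT -gxy; have [] := max_increment_ge e F x y.
Qed.

Lemma remetrize : has_countable_base B -> exists g : M -> M -> K,
  [/\ quasimetric_fun X g, definable_fun2 g,
      forall V, open_for X g V <-> open_for X f V,
      forall V, open_for X (fun x y => g y x) V <-> open_for X (fun x y => f y x) V &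
      forall E, E ∈ B <-> bounded_for X g E].
Proof.
move=> [A [hA [S [h [hS hh]]]]].
have [F [dF F_ge0 F_bd F_usc F_lsc]] := layers_exhaustion hA hS hh.
have eqm := truncate_quasimetric fqm; have de := def_truncate df.
exists (max_increment (truncate f) F); split.
- exact: max_increment_quasimetric.
- by move=> s t ds dt; rewrite /max_increment; definability; apply: dF; definability.
- move=> V; split; apply: open_for_finer => x eps xX eps0.
    (* Semicontinuity gives a weak inequality while balls are strict, hence the half. *)
    have [|del del0 usc] := F_usc x (eps / 2) xX; first by lra.
    exists (Num.min del eps); first by rewrite lt_min del0.
    move=> y yX; rewrite lt_min => /andP [fd fe]; apply/max_increment_lt; split.
      exact: le_lt_trans (truncate_le f x y) fe.
    have := usc y yX (le_lt_trans (truncate_le f x y) fd); lra.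
  exists (Num.min eps 1); first by rewrite lt_min eps0 ltr01.
  by move=> y yX /max_increment_lt [/truncate_lt].
- move=> V; split; apply: open_for_finer => x eps xX eps0.
    have [|del del0 lsc] := F_lsc x (eps / 2) xX; first by lra.
    exists (Num.min del eps); first by rewrite lt_min del0.
    move=> y yX; rewrite lt_min => /andP [fd fe]; apply/max_increment_lt; split.
      exact: le_lt_trans (truncate_le f y x) fe.
    have := lsc y yX (le_lt_trans (truncate_le f y x) fd); lra.
  exists (Num.min eps 1); first by rewrite lt_min eps0 ltr01.
  by move=> y yX /max_increment_lt [/truncate_lt].
- move=> E; rewrite F_bd; split=> -[EX].
    move=> [b Eb]; split=> //; have [x xX] := X_inh; exists x; split=> //.
    (* The radius must be positive and exceed both 1, the bound on the truncated part, and [b],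
       which bounds F y - F x because F x is nonnegative. *)
    exists (Num.max b 0 + 2).
      have : 0 <= Num.max b 0 by rewrite le_max lexx orbT.
      lra.
    move=> y yE; apply/max_increment_lt.
    have b1 : b <= Num.max b 0 by rewrite le_max lexx.
    have b2 : 0 <= Num.max b 0 by rewrite le_max lexx orbT.
    have := truncate_le1 f x y; have := Eb y yE; have := F_ge0 x xX.
    by split; lra.
  move=> [x [xX [r r0 sub]]]; split=> //; exists (F x + r) => y yE.
  by have /max_increment_lt [_] := sub y yE; lra.
Qed.

End Backward.

Theorem theorem1p10 (M : interp) (hZF : ZF M)
    (R : ofield M) (hR : real_line R)
    (X t1 t2 B : M) (hX : exists x, x ∈ X)
    (hT : bitopological X t1 t2) (hB : bornology X B) :
  quasi_metrizable_biuniverse R X t1 t2 B <->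
  has_countable_base B /\ proper X t1 t2 B /\ quasi_metrizable R X t1 t2.
Proof.
split=> [[d [dqm [ind hbd]]]|[base [prop [d [dqm ind]]]]].
  have [f [rep fqm df]] := quasi_metric_represented (hR := hR) dqm.
  have [ht1 ht2] := (inducesE t1 t2 rep).1 ind.
  have hB' A : A ∈ B <-> bounded_for X f A by rewrite -(d_boundedE A rep); apply: hbd.
  (* Bounded sets need a centre: over an empty [X] no set is bounded, although the bornology
     consisting of the empty set satisfies the other side of the equivalence. *)
  have [x0 x0X] := hX.
  split; first exact: (bounded_countable_base fqm df x0X hB').
  split; first exact: (bounded_proper fqm df ht1 ht2 hB').
  by exists d.
have [f [rep fqm df]] := quasi_metric_represented (hR := hR) dqm.
have [ht1 ht2] := (inducesE t1 t2 rep).1 ind.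
have [g [gqm dg og1 og2 gB]] := remetrize fqm df ht1 ht2 hB prop hX base.
have [d' [d'qm rep']] := represented_quasi_metric gqm dg.
exists d'; split=> //; split.
  apply/(inducesE _ _ rep'); split=> V; rewrite ?og1 ?og2; [exact: ht1 | exact: ht2].
by move=> E; rewrite (d_boundedE E rep'); apply: gB.
Qed.
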